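(* Let $u$ be a compactly supported distribution on $\mathbb{C}$. Then $u$ is weakly multiplicative if and only if $u=0$ or $u=p(\partial)q(\overline{\partial})\delta_a$, where $a\in\mathbb{C}$ and $p,q$ are complex polynomials (in one variable) with $p(0)=q(0)=1$.
   Context: $C^\infty(\mathbb{C})$ denotes the space of smooth complex-valued functions on $\mathbb{C}\cong\mathbb{R}^2$ with the Fréchet-space topology of uniform convergence of all derivatives on compact sets. A compactly supported distribution $u$ on $\mathbb{C}$ is a continuous (complex-)linear functional on $C^\infty(\mathbb{C})$, and $\langle u,\psi\rangle$ denotes $u(\psi)$. Such a $u$ is called weakly multiplicative if, for every pair of entire functions $f,g:\mathbb{C}\to\mathbb{C}$, $$\langle u,f\overline{g}\rangle=\langle u,f\rangle\langle u,\overline{g}\rangle.$$ The Cauchy–Riemann operators are $\partial:=\frac12(\partial_x-i\partial_y)$ and $\overline{\partial}:=\frac12(\partial_x+i\partial_y)$, where $z=x+iy$. They act on distributions in the usual way, $\langle \partial u,\psi\rangle=-\langle u,\partial\psi\rangle$ and $\langle \overline{\partial}u,\psi\rangle=-\langle u,\overline{\partial}\psi\rangle$. For polynomials $p,q$, the expressions $p(\partial)$ and $q(\overline\partial)$ denote the corresponding constant-coefficient differential operators. $\delta_a$ is the Dirac distribution at $a$, i.e. $\langle\delta_a,\psi\rangle=\psi(a)$. *)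

(* Defs.v *)
From HB Require Import structures.
From mathcomp Require Import all_boot all_order all_algebra.
From mathcomp Require Import complex ring.
From mathcomp Require Import all_classical all_reals all_analysis.

Set Implicit Arguments.
Unset Strict Implicit.
Unset Printing Implicit Defensive.

Import Order.TTheory GRing.Theory Num.Theory numFieldNormedType.Exports.

Local Open Scope classical_set_scope.
Local Open Scope ring_scope.
Local Open Scope complex_scope.

(* [R[i]] alone carries no topology in the library; its regular algebra
   [R[i]^o] does, and is a normed module over [R[i]], so that [derivable f z 1]
   is complex differentiability for [f : Cplx R -> Cplx R]. *)
Notation Cplx R := (R[i]^o).

Section curves.
Variable R : realType.
Implicit Types (h k : R -> Cplx R) (t : R) (c : Cplx R).

Definition cderivable h t :=
  derivable (fun s => complex.Re (h s)) t 1 /\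
  derivable (fun s => complex.Im (h s)) t 1.

Definition cderive h t : Cplx R :=
  ((fun s => complex.Re (h s))^`() t)%classic +i*
  ((fun s => complex.Im (h s))^`() t)%classic.

Let is_cderive h t (d : Cplx R) :=
  is_derive t (1 : R) (fun s => complex.Re (h s)) (complex.Re d) /\
  is_derive t (1 : R) (fun s => complex.Im (h s)) (complex.Im d).

Let cderivableE h t : cderivable h t -> is_cderive h t (cderive h t).
Proof.
move=> [dr di]; split.
  by rewrite [complex.Re _]derive1E; exact: derivableP.
by rewrite [complex.Im _]derive1E; exact: derivableP.
Qed.

Let is_cderiveE h t d : is_cderive h t d -> cderivable h t /\ cderive h t = d.
Proof.
move=> [dr di]; split.
  by split; [case: dr | case: di].
by rewrite /cderive !derive1E !derive_val; case: (d).
Qed.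

Lemma cderiveD h k t : cderivable h t -> cderivable k t ->
  cderivable (fun s => h s + k s) t /\
  cderive (fun s => h s + k s) t = cderive h t + cderive k t.
Proof.
move=> /cderivableE[hr hi] /cderivableE[kr ki]; apply: is_cderiveE.
split.
  rewrite (_ : (fun s => _) =
    (fun s => complex.Re (h s)) \+ (fun s => complex.Re (k s))).
    by rewrite raddfD; exact: is_deriveD.
  by apply/funext => s /=; rewrite raddfD.
rewrite (_ : (fun s => _) =
  (fun s => complex.Im (h s)) \+ (fun s => complex.Im (k s))).
  by rewrite raddfD; exact: is_deriveD.
by apply/funext => s /=; rewrite raddfD.
Qed.

Lemma cderiveM h k t : cderivable h t -> cderivable k t ->
  cderivable (fun s => h s * k s) t /\
  cderive (fun s => h s * k s) t = cderive h t * k t + h t * cderive k t.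
Proof.
move=> /cderivableE[hr hi] /cderivableE[kr ki]; apply: is_cderiveE.
move: hr hi kr ki; set dh := cderive h t; set dk := cderive k t => hr hi kr ki.
have ReM (a b : Cplx R) : complex.Re (a * b) =
    complex.Re a * complex.Re b - complex.Im a * complex.Im b.
  by case: a b => [? ?] [? ?].
have ImM (a b : Cplx R) : complex.Im (a * b) =
    complex.Re a * complex.Im b + complex.Im a * complex.Re b.
  by case: a b => [? ?] [? ?].
have ReMD (a b c d : Cplx R) : complex.Re (a * b + c * d) =
    complex.Re a * complex.Re b - complex.Im a * complex.Im b +
    (complex.Re c * complex.Re d - complex.Im c * complex.Im d).
  by case: a b c d => [? ?] [? ?] [? ?] [? ?].
have ImMD (a b c d : Cplx R) : complex.Im (a * b + c * d) =
    complex.Re a * complex.Im b + complex.Im a * complex.Re b +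
    (complex.Re c * complex.Im d + complex.Im c * complex.Re d).
  by case: a b c d => [? ?] [? ?] [? ?] [? ?].
split.
- rewrite (_ : (fun s => _) =
    (fun s => complex.Re (h s)) * (fun s => complex.Re (k s)) -
    (fun s => complex.Im (h s)) * (fun s => complex.Im (k s))); last first.
    by apply/funext => s; exact: ReM.
  apply: (is_derive_eq (is_deriveB (is_deriveM hr kr) (is_deriveM hi ki))).
  rewrite [RHS]ReMD /GRing.scale /=.
  rewrite /dh /dk /cderive /=; ring.
- rewrite (_ : (fun s => _) =
    (fun s => complex.Re (h s)) * (fun s => complex.Im (k s)) +
    (fun s => complex.Im (h s)) * (fun s => complex.Re (k s))); last first.
    by apply/funext => s; exact: ImM.
  apply: (is_derive_eq (is_deriveD (is_deriveM hr ki) (is_deriveM hi kr))).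
  rewrite [RHS]ImMD /GRing.scale /=.
  rewrite /dh /dk /cderive /=; ring.
Qed.

Lemma cderive_cst c t :
  cderivable (fun=> c) t /\ cderive (fun=> c) t = 0.
Proof.
by apply: is_cderiveE; split => /=; exact: is_derive_cst.
Qed.

Lemma cderive_conj h t : cderivable h t ->
  cderivable (fun s => (h s)^*) t /\
  cderive (fun s => (h s)^*) t = (cderive h t)^*.
Proof.
move=> /cderivableE[hr hi]; apply: is_cderiveE; split.
  rewrite (_ : (fun s => _) = fun s => complex.Re (h s)) //.
  by apply/funext => s; case: (h s).
rewrite (_ : (fun s => _) = - fun s => complex.Im (h s)).
  exact: is_deriveN.
by apply/funext => s /=; rewrite /GRing.opp /=; case: (h s).
Qed.

End curves.

Section smooth.
Variable R : realType.
Local Notation C := (Cplx R).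
Implicit Types (f g : C -> C) (c z : C) (n : nat).

Definition xline f z : R -> C := fun t => f (t +i* complex.Im z).
Definition yline f z : R -> C := fun t => f (complex.Re z +i* t).

Definition dx f : C -> C := fun z => cderive (xline f z) (complex.Re z).
Definition dy f : C -> C := fun z => cderive (yline f z) (complex.Im z).

Fixpoint Cn n f : Prop :=
  continuous f /\
  if n is m.+1 then
    [/\ forall z, cderivable (xline f z) (complex.Re z) /\
                  cderivable (yline f z) (complex.Im z),
        Cn m (dx f) & Cn m (dy f)]
  else True.

Definition smooth f := forall n, Cn n f.

Definition conjf f : C -> C := fun z => (f z)^*.

Lemma Cn_continuous n f : Cn n f -> continuous f.
Proof. by case: n => [|n] []. Qed.

Lemma CnW n f : Cn n.+1 f -> Cn n f.
Proof.
elim: n f => [|n IHn] f [cf [df fx fy]]; first by split.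
split; first exact: cf.
split; [exact: df | exact: (IHn _ fx) | exact: (IHn _ fy)].
Qed.

Lemma Cn_cst n c : Cn n (fun=> c).
Proof.
elim: n c => [|n IHn] c; split; do ?exact: cst_continuous.
  by [].
split.
- by move=> z; split; exact: (cderive_cst _ _).1.
- rewrite (_ : dx _ = fun=> 0); first exact: IHn.
  by apply/funext => z; exact: (cderive_cst _ _).2.
- rewrite (_ : dy _ = fun=> 0); first exact: IHn.
  by apply/funext => z; exact: (cderive_cst _ _).2.
Qed.

Let reimE z : complex.Re z +i* complex.Im z = z.
Proof. by case: z. Qed.

Lemma CnD n f g : Cn n f -> Cn n g -> Cn n (f + g).
Proof.
elim: n f g => [|n IHn] f g.
  move=> [cf _] [cg _]; split; last by [].
  by move=> z; exact: (cvgD (cf z) (cg z)).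
move=> [cf [df fx fy]] [cg [dg gx gy]]; split.
  by move=> z; exact: (cvgD (cf z) (cg z)).
split.
- move=> z; have [fxz fyz] := df z; have [gxz gyz] := dg z.
  by split; [exact: (cderiveD fxz gxz).1 | exact: (cderiveD fyz gyz).1].
- rewrite (_ : dx _ = dx f + dx g); first exact: (IHn _ _ fx gx).
  by apply/funext => z; exact: (cderiveD (df z).1 (dg z).1).2.
- rewrite (_ : dy _ = dy f + dy g); first exact: (IHn _ _ fy gy).
  by apply/funext => z; exact: (cderiveD (df z).2 (dg z).2).2.
Qed.

Lemma CnM n f g : Cn n f -> Cn n g -> Cn n (f * g).
Proof.
elim: n f g => [|n IHn] f g.
  move=> [cf _] [cg _]; split; last by [].
  by move=> z; exact: (cvgM (cf z) (cg z)).
move=> Cf Cg; have [cf [df fx fy]] := Cf; have [cg [dg gx gy]] := Cg; split.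
  by move=> z; exact: (cvgM (cf z) (cg z)).
split.
- move=> z; have [fxz fyz] := df z; have [gxz gyz] := dg z.
  by split; [exact: (cderiveM fxz gxz).1 | exact: (cderiveM fyz gyz).1].
- rewrite (_ : dx _ = dx f * g + f * dx g).
    exact: (CnD (IHn _ _ fx (CnW Cg)) (IHn _ _ (CnW Cf) gx)).
  apply/funext => z; have := (cderiveM (df z).1 (dg z).1).2.
  by rewrite /xline reimE.
- rewrite (_ : dy _ = dy f * g + f * dy g).
    exact: (CnD (IHn _ _ fy (CnW Cg)) (IHn _ _ (CnW Cf) gy)).
  apply/funext => z; have := (cderiveM (df z).2 (dg z).2).2.
  by rewrite /yline reimE.
Qed.

Lemma conjf_continuous f : continuous f -> continuous (conjf f).
Proof.
move=> cf z; have := @cvgrPdist_lt _ C C (nbhs z) _ f (f z).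
have := @cvgrPdist_lt _ C C (nbhs z) _ (conjf f) (conjf f z).
move=> [_ Hconj] [Hf _]; apply: Hconj => e e0.
apply: filterS (Hf (cf z) e e0) => w.
by rewrite /conjf -[(f z)^* - _](raddfB (@conjc R)) normcJ.
Qed.

Lemma Cn_conjf n f : Cn n f -> Cn n (conjf f).
Proof.
elim: n f => [|n IHn] f.
  by move=> [cf _]; split; first exact: conjf_continuous.
move=> [cf [df fx fy]]; split; first exact: conjf_continuous.
split.
- move=> z; have [fxz fyz] := df z.
  by split; [exact: (cderive_conj fxz).1 | exact: (cderive_conj fyz).1].
- rewrite (_ : dx _ = conjf (dx f)); first exact: (IHn _ fx).
  by apply/funext => z; exact: (cderive_conj (df z).1).2.
- rewrite (_ : dy _ = conjf (dy f)); first exact: (IHn _ fy).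
  by apply/funext => z; exact: (cderive_conj (df z).2).2.
Qed.

Lemma smooth_dx f : smooth f -> smooth (dx f).
Proof. by move=> sf n; case: (sf n.+1) => _ []. Qed.

Lemma smooth_dy f : smooth f -> smooth (dy f).
Proof. by move=> sf n; case: (sf n.+1) => _ []. Qed.

Lemma smoothM f g : smooth f -> smooth g -> smooth (f * g).
Proof. by move=> sf sg n; apply: CnM; [exact: sf | exact: sg]. Qed.

Lemma smooth_conjf f : smooth f -> smooth (conjf f).
Proof. by move=> sf n; exact/Cn_conjf/sf. Qed.

Definition smooth_pred : {pred C -> C} := fun f => `[< smooth f >].

Lemma smooth_submod_closed : submod_closed smooth_pred.
Proof.
split; first by apply/asboolP => n; exact: Cn_cst.
move=> c f g /asboolP sf /asboolP sg; apply/asboolP => n; apply: CnD; last exact: sg.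
exact: (CnM (Cn_cst n c) (sf n)).
Qed.

HB.instance Definition _ :=
  GRing.isSubmodClosed.Build R[i] (C -> C) smooth_pred smooth_submod_closed.

Record Cinf := MkCinf { cinf_fun :> C -> C; _ : cinf_fun \in smooth_pred }.

HB.instance Definition _ := [isSub for cinf_fun].
HB.instance Definition _ := [Choice of Cinf by <:].
HB.instance Definition _ := [SubChoice_isSubLmodule of Cinf by <:].

Lemma CinfP (f : Cinf) : smooth f.
Proof. by case: f => f /= /asboolP. Qed.

Definition to_Cinf f (sf : smooth f) : Cinf := MkCinf (asboolT sf).

Definition Cinf_dx (f : Cinf) := to_Cinf (smooth_dx (CinfP f)).
Definition Cinf_dy (f : Cinf) := to_Cinf (smooth_dy (CinfP f)).
Definition Cinf_mul (f g : Cinf) := to_Cinf (smoothM (CinfP f) (CinfP g)).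
Definition Cinf_conj (f : Cinf) := to_Cinf (smooth_conjf (CinfP f)).

(* All partial derivatives, each in the space of functions with the topology
   of uniform convergence on compact sets; [Cinf] carries the initial topology
   of this map. *)
Definition partials (phi : Cinf) :
    prod_topology (fun _ : nat * nat => {family compact, C -> C}) :=
  fun jk => iter jk.1 dx (iter jk.2 dy phi).

HB.instance Definition _ :=
  Topological.copy Cinf (@initial_topology Cinf _ partials).

Definition del (phi : Cinf) : Cinf :=
  (2%:R : R[i])^-1 *: (Cinf_dx phi - ('i : R[i]) *: Cinf_dy phi).
Definition delbar (phi : Cinf) : Cinf :=
  (2%:R : R[i])^-1 *: (Cinf_dx phi + ('i : R[i]) *: Cinf_dy phi).

Implicit Type u : Cinf -> C.

Definition distr_del u : Cinf -> C := fun phi => - u (del phi).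
Definition distr_delbar u : Cinf -> C := fun phi => - u (delbar phi).

(* [poly_op p D u] is [p(D) u]. *)
Definition poly_op (p : {poly R[i]}) (D : (Cinf -> C) -> (Cinf -> C)) u :
    Cinf -> C :=
  \sum_(k < size p) p`_k *: iter k D u.

Definition dirac_distr (a : C) : Cinf -> C := fun phi => phi a.

Definition entire f := forall z : C, derivable f z 1.

(* Entire functions are smooth, and are paired with [u] as elements of
   [Cinf]. *)
Definition weakly_multiplicative u :=
  forall f g : Cinf, entire f -> entire g ->
    u (Cinf_mul f (Cinf_conj g)) = u f * u (Cinf_conj g).

End smooth.

(* Main.v *)
Require Import Defs.
From HB Require Import structures.
From mathcomp Require Import all_boot all_order all_algebra.
From mathcomp Require Import cyclic separable cyclotomic.
From mathcomp Require Import complex ring lra.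
From mathcomp Require Import all_classical all_reals all_analysis.

(** Weakly multiplicative distributions are point distributions.

Write [E_s = exp (s (z - a))].  For weakly multiplicative [u] and polynomials
[f], [g],
  [u (f E_s conj (g E_(-s))) = u (f E_s) * u (conj (g E_(-s)))].
On the left, [E_s conj E_(-s)] has modulus one, because its exponent
[s (z - a) - conj (s (z - a))] is imaginary, so the finite order of [u] bounds
the left side by a power of [1 + |s|].  On the right, [u (f E_s)] and the
conjugate of [u (conj (g E_(-s)))] are entire functions of [s], whose power
series are given by the moments of [u].  By the Cauchy estimates their product
is a polynomial in [s], of degree at most a number [D] which depends neither
on [f] and [g] nor on [a] ([moment_product_vanishes]).

Algebra does the rest ([moments_vanish]).  With [g = 1] and [a = 0], the
coefficients of degree at most [D] are finitely many linear conditions on [f],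
so some [c <> 0] satisfies them all; the product of the two series then
vanishes, and as the antiholomorphic factor has constant term 1 the
holomorphic moments are killed by [c].  A root [a] of [c] and a
suitable multiple of a partial product of [c] give [f] with [u f <> 0] and
[u (f (z - a) h) = 0] for all [h]; for this [f] the holomorphic factor is a
nonzero constant, so that the antiholomorphic moments of [u] about [a] vanish
beyond degree [D].  The last nonvanishing one serves as [g] for the
holomorphic moments.  Hence [u] agrees with some [p(del) q(delbar) delta_a] on
all products of a polynomial with a conjugated polynomial, unless [u 1 = 0],
in which case [u] vanishes on these products.

Such products span the polynomials in [x] and [y], which are dense among the
smooth functions ([polynomials_dense]), and this ends the proof of one
direction.  Conversely, for entire [f] and [g] the Cauchy-Riemann equations
and the commutation of [del] and [delbar] give
  [delbar^l del^k (f conj g) = del^k f * conj (del^l g)],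
so that [p(del) q(delbar) delta_a] splits as a product of a sum over [k] and a
sum over [l] ([point_distr_product]); as [p] and [q] have constant term 1, the
factors are its values at [f] and at [conj g].

The exponential never has to be formed: its Taylor polynomials satisfy the
modulus bound up to a factor 2 once their degree is large compared with [|s|]
([truncated_exp_bound]), the Cauchy estimates for polynomials follow by
averaging over roots of unity, and each coefficient of the product stabilises
as the degree grows. *)

Set Implicit Arguments.
Unset Strict Implicit.
Unset Printing Implicit Defensive.

Import Order.TTheory GRing.Theory Num.Theory numFieldNormedType.Exports.

Local Open Scope classical_set_scope.
Local Open Scope ring_scope.
Local Open Scope complex_scope.

(** * Cauchy estimates for polynomials *)

Section Algebra.
Variable K : numClosedFieldType.

Lemma prim_root_exists n : (0 < n)%N -> exists z : K, n.-primitive_root z.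
Proof.
move=> n0; pose p : {poly K} := 'X^n - 1.
have [r Dp] := closed_field_poly_normal p.
move: Dp; rewrite (monicP _) ?monicXnsubC // scale1r => Dp.
have rn1 : all n.-unity_root r by apply/allP => z; rewrite -root_prod_XsubC -Dp.
have sz_r : (n < (size r).+1)%N.
  by rewrite -(size_prod_XsubC r id) -Dp size_XnsubC.
have [|z] := hasP (has_prim_root n0 rn1 _ sz_r); last by exists z.
by rewrite -separable_prod_XsubC -Dp separable_Xn_sub_1 // pnatr_eq0 -lt0n.
Qed.

(** Averaging [G (r w^k) w^(- k l)] over the powers of a primitive root of unity
    [w] of large order isolates the coefficient of degree [l]. *)
Lemma cauchy_estimate (G : {poly K}) (B r : K) l : 0 < r ->
  (forall s, `|s| = r -> `|G.[s]| <= B) -> `|G`_l| * r ^+ l <= B.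
Proof.
move=> r0 GB; set M := (maxn (size G) l.+1).
have M0 : (0 < M)%N by rewrite leq_max orbT.
have lM : (l < M)%N by rewrite leq_max leqnn orbT.
have [w wP] := prim_root_exists M0.
have w1 : `|w| = 1.
  by apply/eqP; rewrite -(pexpr_eq1 M0) // -normrX (prim_expr_order wP) normr1.
have w0 : w != 0 by rewrite -normr_eq0 w1 oner_eq0.
have avg : \sum_(k < M) G.[r * w ^+ k] * (w ^+ k) ^- l = (G`_l * r ^+ l) *+ M.
  transitivity (\sum_(i < M) \sum_(k < M) G`_i * r ^+ i * (w ^+ i / w ^+ l) ^+ k).
    rewrite exchange_big; apply: eq_bigr => k _ /=.
    rewrite (@horner_coef_wide _ M) ?leq_maxl // mulr_suml.
    apply: eq_bigr => i _; rewrite !exprMn exprVn -!exprM -!mulrA.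
    by rewrite (mulnC i) (mulnC l).
  rewrite (bigD1 (Ordinal lM)) //= [X in _ + X]big1 ?addr0.
    rewrite -mulr_sumr divff ?expf_neq0 //.
    by under eq_bigr do rewrite expr1n; rewrite sumr_const card_ord mulr_natr.
  move=> i ne; rewrite -mulr_sumr; apply/eqP; rewrite mulf_eq0; apply/orP; right.
  set x := _ / _; have xM : x ^+ M = 1.
    by rewrite exprMn exprVn -!exprM !(mulnC _ M) !exprM (prim_expr_order wP) !expr1n divr1.
  have /eqP := subrX1 x M; rewrite xM subrr eq_sym mulf_eq0 subr_eq0.
  case/orP => // /eqP x1; case/eqP: ne; apply: val_inj => /=.
  have /eqP : w ^+ i = w ^+ l by rewrite -[LHS](divfK (expf_neq0 l w0)) -/x x1 mul1r.
  by rewrite (eq_prim_root_expr wP) !modn_small // => /eqP.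
rewrite -(ler_pMn2r M0) -[r in X in X <= _]gtr0_norm // -normrX -normrM -normrMn -avg.
apply: le_trans (ler_norm_sum _ _ _) _.
rewrite -[X in _ *+ X]card_ord -sumr_const; apply: ler_sum => k _.
rewrite normrM normfV !normrX w1 !expr1n invr1 mulr1; apply: GB.
by rewrite normrM normrX w1 expr1n mulr1 gtr0_norm.
Qed.

Lemma polynomial_growth (g C : K) (D l : nat) : (D < l)%N -> 0 <= C ->
  (forall r, 1 <= r -> `|g| * r ^+ l <= C * (1 + r) ^+ D) -> g = 0.
Proof.
move=> Dl C0 H; apply/eqP/negPn/negP => g0.
have ng : 0 < `|g| by rewrite normr_gt0.
(* Large enough that [`|g| * r] exceeds [C * 2 ^ D], and at least 1. *)
pose r := (C * 2 ^+ D + 1) / `|g| + 1.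
have C2 : 0 <= C * 2 ^+ D by rewrite mulr_ge0 ?exprn_ge0.
have r1 : 1 <= r by rewrite lerDr divr_ge0 ?addr_ge0.
have r0 : 0 < r by apply: lt_le_trans r1.
have /(le_trans _) le1 := H _ r1.
have : `|g| * r ^+ D.+1 <= C * 2 ^+ D * r ^+ D.
  apply: (@le_trans _ _ (C * (1 + r) ^+ D)).
    by apply: le1; rewrite ler_pM2l // ler_weXn2l.
  have le2r : 1 + r <= 2 * r by rewrite mulr_natl mulr2n lerD2r.
  rewrite -mulrA ler_wpM2l // -exprMn; apply: lerXn2r le2r; rewrite nnegrE.
    by rewrite addr_ge0 // ltW.
  by rewrite mulr_ge0 // ltW.
rewrite exprS mulrA ler_pM2r ?exprn_gt0 // /r mulrDr mulr1 mulrCA divff ?gt_eqF // mulr1.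
by rewrite -addrA gerDl lt_geF // ltr_wpDr.
Qed.

End Algebra.

(** * From product series to vanishing moments *)

Section Moments.
Variable K : numClosedFieldType.
Variables alpha beta : {scalar {poly K}}.

(** The coefficient of [s^l] in the product of the generating functions
    [\sum_i alpha (f (X - a)^i) s^i / i!] and
    [\sum_j beta (g (X - a)^j) (- s)^j / j!]. *)
Definition moment_product (f g : {poly K}) (a : K) (l : nat) : K :=
  \sum_(i < l.+1) (alpha (f * ('X - a%:P) ^+ i) / i`!%:R) *
    ((-1) ^+ (l - i) * beta (g * ('X - a%:P) ^+ (l - i)) / (l - i)`!%:R).

Hypotheses (alpha1 : alpha 1 = 1) (beta1 : beta 1 = 1).
Variable D : nat.
Hypothesis slice : forall f g a l, (D < l)%N -> moment_product f g a l = 0.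

Let factr_neq0 i : i`!%:R != 0 :> K.
Proof. by rewrite pnatr_eq0 -lt0n fact_gt0. Qed.

(** The conditions of degree at most [D] are linear in [f] and leave a nonzero
    solution among the polynomials of degree at most [D + 1].  For this solution
    the whole product series vanishes, and its second factor has constant term 1. *)
Lemma moment_recurrence :
  exists2 c : {poly K}, c != 0 & forall h, alpha (c * h) = 0.
Proof.
pose L l : {poly K} -> K := fun f => moment_product f 1 0 l.
have LE l (v : nat -> K) n : L l (\sum_(i < n) v i *: 'X^i) = \sum_(i < n) v i * L l 'X^i.
  rewrite /L /moment_product; under [RHS]eq_bigr do rewrite mulr_sumr.
  rewrite exchange_big; apply: eq_bigr => j _ /=.
  rewrite mulr_suml linear_sum /= !mulr_suml; apply: eq_bigr => i _.
  by rewrite -(scalerAl (v i)) linearZ /= !mulrA.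
(* More unknowns than equations: a nonzero kernel vector exists. *)
pose A : 'M[K]_(D.+2, D.+1) := \matrix_(i, l) L l 'X^i.
have [v vA v0] : exists2 v : 'rV_D.+2, v *m A = 0 & v != 0.
  have /rowV0Pn[v /sub_kermxP vA v0] : kermx A != 0.
    by rewrite -mxrank_eq0 mxrank_ker -lt0n subn_gt0 ltnS rank_leq_col.
  by exists v.
pose c := \poly_(i < D.+2) v 0 (inord i).
have Lc l : L l c = 0.
  have [lD|] := leqP l D; last exact: slice.
  have /rowP/(_ (Ordinal (lD : (l < D.+1)%N))) := vA; rewrite !mxE.
  rewrite /c poly_def (LE _ (fun i => v 0 (inord i))) => vAl; rewrite -[RHS]vAl.
  by apply: eq_bigr => i _; rewrite mxE inord_val.
have cX i : alpha (c * 'X^i) = 0.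
  elim/ltn_ind: i => i IH; have := Lc i.
  rewrite /L /moment_product big_ord_recr /= big1 ?add0r; last first.
    by move=> j _; rewrite subr0 IH // !mul0r.
  rewrite subnn !mul1r subr0 expr0 fact0 beta1 divr1 mulr1 => /eqP.
  by rewrite mulf_eq0 invr_eq0 (negPf (factr_neq0 i)) orbF => /eqP.
exists c; first apply: contra_neq v0 => c0.
  apply/rowP => i; have /polyP/(_ i) := c0.
  by rewrite coef_poly ltn_ord inord_val coef0 mxE.
move=> h; rewrite -[h]coefK poly_def mulr_sumr linear_sum /= big1 // => i _.
by rewrite -scalerAr linearZ /= cX mulr0.
Qed.

(** Among the partial products of the linear factors of [c], there is a last one
    whose multiples [alpha] does not all annihilate. *)
Lemma moment_root : exists (f : {poly K}) (a : K),
  alpha f != 0 /\ forall h, alpha (f * ('X - a%:P) * h) = 0.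
Proof.
have [c c0 ch] := moment_recurrence.
have [r rE] := closed_field_poly_normal c.
have {ch} : forall h, alpha (\prod_(z <- r) ('X - z%:P) * h) = 0.
  move=> h; have := ch ((lead_coef c)^-1 *: h).
  by rewrite {1}rE -scalerAl -scalerAr scalerA mulfV ?scale1r // lead_coef_eq0.
elim: r {rE} => [|z r IH] H.
  by have /eqP := H 1; rewrite big_nil mul1r alpha1 oner_eq0.
have [/IH//|] := pselect (forall h, alpha (\prod_(z <- r) ('X - z%:P) * h) = 0).
move=> /existsNP[h /eqP h0]; exists (\prod_(z <- r) ('X - z%:P) * h), z; split => // k.
rewrite -[RHS](H (h * k)) big_cons; congr (alpha _).
by rewrite -!mulrA [RHS]mulrCA; congr (_ * _); rewrite mulrCA.
Qed.

(** In each of the two steps, one factor of the product series is reduced to a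
    nonzero constant by the choice of [f] or of [g]. *)
Lemma moments_vanish : exists a : K, exists M : nat, forall l, (M < l)%N ->
  alpha (('X - a%:P) ^+ l) = 0 /\ beta (('X - a%:P) ^+ l) = 0.
Proof.
have [f [a [f0 fa]]] := moment_root; exists a, D.
have beta0 l : (D < l)%N -> beta (('X - a%:P) ^+ l) = 0.
  move=> /(slice f 1 a); rewrite /moment_product big_ord_recl big1 ?addr0 => [|i _].
    rewrite /= subn0 expr0 mulr1 mul1r => /eqP; rewrite !mulf_eq0 !invr_eq0.
    by rewrite (negPf f0) !(negPf (factr_neq0 _)) signr_eq0 !orbF !orFb => /eqP.
  by rewrite lift0 exprS (mulrA f) fa !mul0r.
(* The last nonvanishing moment about [a] of the second functional. *)
have [|i|k bk kmax] := @ex_maxnP (fun k => beta (('X - a%:P) ^+ k) != 0) D.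
- by exists 0%N; rewrite expr0 beta1 oner_eq0.
- by apply: contraR; rewrite -ltnNge => /beta0 ->.
move=> l Dl; split; last exact: beta0.
have := slice 1 (('X - a%:P) ^+ k) a Dl.
rewrite /moment_product big_ord_recr /= big1 ?add0r => [|i _].
  rewrite subnn expr0 mulr1 !mul1r => /eqP; rewrite !mulf_eq0 !invr_eq0.
  by rewrite (negPf bk) !(negPf (factr_neq0 _)) !orbF => /eqP.
rewrite -exprD [beta _](_ : _ = 0) ?mulr0 ?mul0r ?mulr0 //.
apply/eqP; rewrite -[_ == _]negbK; apply/negP => /kmax.
by rewrite leqNgt -{1}[k]addn0 ltn_add2l subn_gt0 ltn_ord.
Qed.
End Moments.

(** * Bernstein polynomials *)

(** The recursion avoids binomial coefficients: [bernstein t n i] is the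
    probability of [i] successes in [n] independent trials of probability [t].
    A ring is enough for it, so that it can be evaluated at polynomials. *)
Fixpoint bernstein (K : nzRingType) (t : K) (n i : nat) : K :=
  if n is n'.+1 then
    t * (if i is i'.+1 then bernstein t n' i' else 0) + (1 - t) * bernstein t n' i
  else (i == 0%N)%:R.

Lemma bernstein_rmorph (K L : nzRingType) (f : {rmorphism K -> L}) t n i :
  f (bernstein t n i) = bernstein (f t) n i.
Proof.
elim: n i => [|n IH] i /=; first by rewrite rmorph_nat.
by rewrite rmorphD !rmorphM rmorphB rmorph1 IH; case: i => [|i]; rewrite ?rmorph0 ?IH.
Qed.

Section Bernstein.
Variable K : realFieldType.
Implicit Types (t : K) (phi : nat -> K).

Lemma bernstein_small t n i : (n < i)%N -> bernstein t n i = 0.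
Proof.
elim: n i => [|n IH] [|i] //= ni.
by rewrite !IH ?mulr0 ?addr0 // ltnW.
Qed.

Lemma bernstein_ge0 t n i : 0 <= t -> t <= 1 -> 0 <= bernstein t n i.
Proof.
move=> t0 t1; elim: n i => [|n IH] i /=; first exact: ler0n.
by rewrite addr_ge0 ?mulr_ge0 ?subr_ge0 //; case: i.
Qed.

(** Conditioning on the last trial. *)
Lemma bernstein_sumS t n phi :
  \sum_(i < n.+2) bernstein t n.+1 i * phi i =
  \sum_(i < n.+1) bernstein t n i * (t * phi i.+1 + (1 - t) * phi i).
Proof.
under eq_bigr do rewrite /= mulrDl; rewrite big_split /= big_ord_recl /= mulr0 mul0r add0r.
rewrite [X in _ + X]big_ord_recr /= bernstein_small // mulr0 mul0r addr0 -big_split /=.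
by apply: eq_bigr => i _; ring.
Qed.

Lemma bernstein_sum1 t n : \sum_(i < n.+1) bernstein t n i = 1.
Proof.
elim: n => [|n IH]; first by rewrite big_ord1.
rewrite -[LHS](eq_bigr _ (fun i _ => mulr1 _)) (bernstein_sumS t n (fun=> 1)) -[RHS]IH.
by apply: eq_bigr => i _; rewrite !mulr1 addrC subrK mulr1.
Qed.

Lemma bernstein_variance t n :
  \sum_(i < n.+1) bernstein t n i * (i%:R - n%:R * t) ^+ 2 = n%:R * (t * (1 - t)).
Proof.
elim: n => [|n IH]; first by rewrite big_ord1 /= !mul0r subr0 expr0n mulr0.
rewrite (bernstein_sumS t n (fun i => (i%:R - n.+1%:R * t) ^+ 2)).
transitivity (\sum_(i < n.+1) (bernstein t n i * (i%:R - n%:R * t) ^+ 2 +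
   bernstein t n i * (t * (1 - t)))).
  apply: eq_bigr => i _; rewrite -mulrDr -!natr1; ring.
by rewrite big_split /= -mulr_suml bernstein_sum1 IH mul1r -natr1 mulrDl mul1r.
Qed.

(** Chebyshev: the distance [d] is at most [1 / m + m d^2], and the variance
    controls the second term. *)
Lemma bernstein_deviation t m : 0 <= t -> t <= 1 -> (0 < m)%N ->
  \sum_(i < (m ^ 2).+1) bernstein t (m ^ 2) i * `|t - i%:R / (m ^ 2)%:R| <= 2 / m%:R.
Proof.
move=> t0 t1 m0; set n := (m ^ 2)%N; have mR : 0 < m%:R :> K by rewrite ltr0n.
have nE : n%:R = m%:R ^+ 2 :> K by rewrite natrX.
have nR : 0 < n%:R :> K by rewrite nE exprn_gt0.
apply: (@le_trans _ _ (\sum_(i < n.+1) (bernstein t n i * m%:R^-1 +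
   bernstein t n i * (i%:R - n%:R * t) ^+ 2 * (m%:R / n%:R ^+ 2)))).
  apply: ler_sum => i _; rewrite -mulrA -mulrDr ler_wpM2l ?bernstein_ge0 //.
  set d := t - _; have -> : i%:R - n%:R * t = - d * n%:R.
    by rewrite /d opprB mulrBl divfK ?gt_eqF // (mulrC t).
  rewrite (_ : _ * (m%:R / _) = d ^+ 2 * m%:R); last first.
    by field; rewrite gt_eqF.
  rewrite -[d ^+ 2]real_normK ?num_real //.
  set e := `|d|; rewrite -(ler_pM2r mR) mulrDl mulVf ?gt_eqF //.
  set w := m%:R; nra.
rewrite big_split /= -!mulr_suml bernstein_sum1 bernstein_variance mul1r nE.
rewrite (_ : _ * _ = t * (1 - t) / m%:R); last first.
  by field; rewrite gt_eqF.
rewrite -[X in X + _]mul1r -mulrDl ler_wpM2r ?invr_ge0 ?ler0n //; nra.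
Qed.
End Bernstein.

(** * Truncated exponentials *)

Section TruncatedExponential.
Variable R : realType.

Lemma exp_tail (x : R) : 0 <= x ->
  exists n0, forall m, \sum_(n0 <= l < m) x ^+ l / l`!%:R <= 1.
Proof.
move=> x0.
have nd : nondecreasing_seq (series (exp_coeff x)).
  apply/nondecreasing_seqP => n; rewrite /series /= big_nat_recr //= lerDl.
  by rewrite exp_coeff_ge0.
have cv := @is_cvg_series_exp_coeff R x.
have := @cvgrPdist_lt R R nat \oo _ (series (exp_coeff x)) (expR x).
move=> [/(_ cv) /(_ _ ltr01) [n0 _ n0P] _]; exists n0 => m.
have [nm|mn] := leqP n0 m; last by rewrite big_geq ?ler01 // ltnW.
have := n0P n0 (leqnn n0); have := nondecreasing_cvgn_le nd cv m.
rewrite -/(expR x) => le_exp /ltr_normlW lt1.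
have E : series (exp_coeff x) m =
    series (exp_coeff x) n0 + \sum_(n0 <= l < m) x ^+ l / l`!%:R.
  by rewrite /series /= (big_cat_nat (n:=n0)).
rewrite -(lerD2l (series (exp_coeff x) n0)) -E; apply: (le_trans le_exp).
by rewrite -lerBlDl; exact: ltW.
Qed.

(** The binomial theorem in the form in which it multiplies exponential series. *)
Lemma sum_factV (K : numFieldType) (x y : K) l :
  \sum_(i < l.+1) x ^+ (l - i) * y ^+ i / ((l - i)`!%:R * i`!%:R) = (x + y) ^+ l / l`!%:R.
Proof.
rewrite exprDn mulr_suml; apply: eq_bigr => i _.
have il : (i <= l)%N by rewrite -ltnS.
have fn0 n : n`!%:R != 0 :> K by rewrite pnatr_eq0 -lt0n fact_gt0.
rewrite -[X in _ = X / _]mulr_natr -!mulrA; congr (_ * (_ * _)).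
rewrite -(bin_fact il) !natrM invfM [X in _ = _ * X]invfM mulrA mulfV ?mul1r.
  by rewrite mulrC -invfM.
by rewrite pnatr_eq0 -lt0n bin_gt0.
Qed.

(** The coefficients of the product of the Taylor polynomials at [w] and [- w]
    agree with those of the constant series 1 up to degree [n0], and the further ones are
    bounded by those of [exp (2 w)]. *)
Lemma truncated_exp_bound (rho : R) : 0 <= rho ->
  exists n0, forall n1 n2 (w : R[i]), (n0 <= n1)%N -> (n0 <= n2)%N -> `|w| <= rho%:C ->
  `|(\sum_(i < n1.+1) w ^+ i / i`!%:R) * (\sum_(j < n2.+1) (- w) ^+ j / j`!%:R)| <= 2.
Proof.
move=> r0; have [n0 n0P] := exp_tail (mulr_ge0 (ler0n _ 2) r0).
exists n0 => n1 n2 w n01 n02 wr.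
pose p1 : {poly R[i]} := \poly_(i < n1.+1) (i`!%:R)^-1.
pose p2 : {poly R[i]} := \poly_(i < n2.+1) ((-1) ^+ i / i`!%:R).
have -> : \sum_(i < n1.+1) w ^+ i / i`!%:R = p1.[w].
  by rewrite horner_poly; apply: eq_bigr => i _; rewrite mulrC.
have -> : \sum_(i < n2.+1) (- w) ^+ i / i`!%:R = p2.[w].
  by rewrite horner_poly; apply: eq_bigr => i _; rewrite (exprNn w) mulrAC.
rewrite -hornerM; set p := p1 * p2; pose m := maxn (size p) n0.+1.
have p0 : p`_0 = 1.
  by rewrite /p coefM big_ord1 subn0 !coef_poly /= expr0 fact0 invr1 !mulr1.
have plow l : (0 < l)%N -> (l <= n0)%N -> p`_l = 0.
  move=> l0 ln; rewrite /p coefMr; transitivity ((1 - 1) ^+ l / l`!%:R : R[i]); last first.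
    by rewrite subrr expr0n gtn_eqF // mul0r.
  rewrite -sum_factV; apply: eq_bigr => i _ /=.
  have il : (i <= l)%N by rewrite -ltnS.
  rewrite !coef_poly !ltnS (leq_trans (leq_subr _ _) (leq_trans ln n01)).
  by rewrite (leq_trans il (leq_trans ln n02)) expr1n invfM mul1r mulrCA.
have pall l : `|p`_l| <= 2 ^+ l / l`!%:R.
  rewrite /p coefMr (_ : 2 = 1 + 1 :> R[i]) -?sum_factV //.
  apply: le_trans (ler_norm_sum _ _ _) _; apply: ler_sum => i _.
  have fV n : 0 <= (n`!%:R)^-1 :> R[i] by rewrite invr_ge0 ler0n.
  rewrite normrM !expr1n mulr1 mul1r invfM ler_pM //.
    by rewrite coef_poly; case: ifP => _; rewrite ?normr0 ?ger0_norm.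
  rewrite coef_poly; case: ifP => _; rewrite ?normr0 //.
  by rewrite normrM normrX normrN1 expr1n mul1r ger0_norm.
rewrite (@horner_coef_wide _ m) ?leq_maxl // -(big_mkord xpredT (fun i => p`_i * w ^+ i)).
rewrite (big_cat_nat (n:=n0.+1)) //= ?leq_maxr // big_ltn // big_nat big1 ?addr0; last first.
  by move=> l /andP[l0 ln]; rewrite plow ?mul0r.
rewrite p0 expr0 mulr1 (_ : 2 = 1 + 1 :> R[i]) //.
apply: le_trans (ler_normD _ _) _; rewrite normr1 lerD2l.
apply: le_trans (ler_norm_sum _ _ _) _.
have : \sum_(n0 <= l < m) (2 * rho) ^+ l / l`!%:R <= 1 by [].
rewrite -lecR rmorph_sum rmorph1; apply: le_trans.
rewrite [leRHS]big_ltn ?leq_maxr //.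
rewrite -[leLHS]add0r; apply: lerD.
  by rewrite ler0c divr_ge0 ?exprn_ge0 ?mulr_ge0 ?ler0n.
rewrite !big_nat; apply: ler_sum => l _.
rewrite normrM normrX rmorphM rmorphXn rmorphM fmorphV !rmorph_nat exprMn mulrAC.
apply: ler_pM; rewrite ?exprn_ge0 ?pall //.
by apply: lerXn2r wr; rewrite nnegrE; [exact: normr_ge0 | rewrite ler0c].
Qed.
End TruncatedExponential.

(** * The topology of the complex plane *)

Section ComplexPlane.
Variable R : realType.
Local Notation C := (Cplx R).
Implicit Types (z w : C).

Lemma normc_ge_Im z : `|complex.Im z|%:C <= `|z : R[i]|.
Proof.
case: z => a b /=; rewrite normc_def /= lecR -sqrtr_sqr ler_wsqrtr //.
by rewrite lerDr sqr_ge0.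
Qed.

Lemma normc_le_ReIm z : `|z : R[i]| <= (`|complex.Re z| + `|complex.Im z|)%:C.
Proof.
rewrite {1}(complexE z); apply: le_trans (ler_normD _ _) _.
rewrite rmorphD /= lerD //; first by rewrite normc_def /= expr0n addr0 sqrtr_sqr.
by rewrite normrM !normc_def /= !expr0n /= add0r addr0 expr1n sqrtr1 mul1r sqrtr_sqr.
Qed.

Lemma Re_continuous : continuous (fun z : C => complex.Re z).
Proof.
move=> z; apply/(@cvgrPdist_lt R R C (nbhs z) _) => e e0.
have e0' : (0 : R[i]) < e%:C by rewrite ltcR.
have nb := @nbhsx_ballx _ C z _ e0'.
apply: (@filterS _ (nbhs (z : C)) _ _ _ _ nb) => w; rewrite -ball_normE /ball_ /=.
move=> zw; rewrite -ltcR; apply: le_lt_trans zw.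
have := normc_ge_Re (z - w); rewrite raddfB; exact.
Qed.

Lemma Im_continuous : continuous (fun z : C => complex.Im z).
Proof.
move=> z; apply/(@cvgrPdist_lt R R C (nbhs z) _) => e e0.
have e0' : (0 : R[i]) < e%:C by rewrite ltcR.
have nb := @nbhsx_ballx _ C z _ e0'.
apply: (@filterS _ (nbhs (z : C)) _ _ _ _ nb) => w; rewrite -ball_normE /ball_ /=.
move=> zw; rewrite -ltcR; apply: le_lt_trans zw.
have := normc_ge_Im (z - w); rewrite raddfB; exact.
Qed.

Lemma cplx_continuous : continuous (fun p : R * R => p.1 +i* p.2 : C).
Proof.
move=> p; apply/(@cvgrPdist_lt _ C _ (nbhs p) _) => e e0.
have [d d0 de] : exists2 d : R, 0 < d & (d + d)%:C <= e :> R[i].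
  case: e e0 => a b; rewrite ltcE /= => /andP[/eqP -> a0].
  by exists (a / 2); rewrite ?divr_gt0 // -splitr lecR.
have : \forall q \near p, ball p d q by exact: nbhsx_ballx.
apply: filterS => q [] /=; rewrite -!ball_normE /ball_ /= => d1 d2.
apply: le_lt_trans (normc_le_ReIm _) _; apply: lt_le_trans de; rewrite ltcR.
by apply: ltrD.
Qed.

(** Closed squares centred at 0 exhaust the compact sets and fit the
    coordinatewise estimates. *)
Definition csquare (r : R) : set C :=
  [set z | `|complex.Re z| <= r /\ `|complex.Im z| <= r].

Lemma csquare_compact r : compact (csquare r).
Proof.
have -> : csquare r = (fun p : R * R => p.1 +i* p.2 : C) @` (`[- r, r] `*` `[- r, r]).
  apply/seteqP; split=> [[x y] [/= xr yr]|_ [[x y] [/= xr yr]] <-].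
    by exists (x, y) => //=; rewrite !in_itv /= -!ler_norml.
  by move: xr yr; rewrite !in_itv /= -!ler_norml.
apply: continuous_compact; first by apply: continuous_subspaceT; exact: cplx_continuous.
by apply: compact_setX; exact: segment_compact.
Qed.

Lemma compact_real_bound (T : topologicalType) (A : set T) (f : T -> R) :
  continuous f -> compact A -> exists r, forall t, A t -> `|f t| <= r.
Proof.
move=> cf cA.
have : bounded_set (f @` A).
  by apply: compact_bounded; apply: continuous_compact => //; exact: continuous_subspaceT.
move=> [M [_ MP]]; exists (M + 1) => t At.
by apply: MP; [rewrite ltrDl | exists t].
Qed.

Lemma compact_csquare (A : set C) : compact A -> exists r, A `<=` csquare r.
Proof.
move=> cA.
have [r1 H1] := @compact_real_bound C A _ (@Re_continuous) cA.
have [r2 H2] := @compact_real_bound C A _ (@Im_continuous) cA.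
exists (Num.max r1 r2) => z Az.
by split; rewrite le_max ?H1 ?H2 ?orbT.
Qed.

Lemma csquare_bound (f : C -> C) r : continuous f ->
  exists2 M : R, 0 < M & forall z, csquare r z -> `|f z : R[i]| <= M%:C.
Proof.
move=> cf.
have [r1 H1] := @compact_real_bound C _ (fun z => complex.Re (f z))
  (fun z => continuous_comp (cf z) (@Re_continuous (f z))) (@csquare_compact r).
have [r2 H2] := @compact_real_bound C _ (fun z => complex.Im (f z))
  (fun z => continuous_comp (cf z) (@Im_continuous (f z))) (@csquare_compact r).
exists (`|r1| + `|r2| + 1); first by rewrite ltr_wpDl // addr_ge0.
move=> z rz; apply: le_trans (normc_le_ReIm _) _; rewrite lecR.
rewrite ler_wpDr // lerD //.
  by apply: le_trans (H1 _ rz) (ler_norm _).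
by apply: le_trans (H2 _ rz) (ler_norm _).
Qed.

End ComplexPlane.

(** * Calculus on smooth functions and distributions of finite order *)

Section CinfOps.
Variable R : realType.
Local Notation C := (Cplx R).
Local Notation Cinf := (Cinf R).
Implicit Types (z w : C) (f g phi psi : Cinf) (c : R[i]).

Lemma CinfE f g : (forall z, f z = g z) -> f = g.
Proof. by move=> fg; apply: val_inj; apply/funext => z; exact: fg. Qed.

Lemma Cinf_cderivable_x f z : cderivable (xline f z) (complex.Re z).
Proof. by have [_ [/(_ z) []]] := CinfP f 1%N. Qed.

Lemma Cinf_cderivable_y f z : cderivable (yline f z) (complex.Im z).
Proof. by have [_ [/(_ z) []]] := CinfP f 1%N. Qed.

Lemma cplxE z : complex.Re z +i* complex.Im z = z. Proof. by case: z. Qed.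

Lemma Cinf_continuous f : continuous f.
Proof. exact: Cn_continuous (CinfP f 0). Qed.

Lemma Cinf_dxM f g : Cinf_dx (Cinf_mul f g) =
  Cinf_mul (Cinf_dx f) g + Cinf_mul f (Cinf_dx g).
Proof.
apply: CinfE => z /=; have := (cderiveM (Cinf_cderivable_x f z) (Cinf_cderivable_x g z)).2.
by rewrite /xline cplxE.
Qed.

Lemma Cinf_dyM f g : Cinf_dy (Cinf_mul f g) =
  Cinf_mul (Cinf_dy f) g + Cinf_mul f (Cinf_dy g).
Proof.
apply: CinfE => z /=; have := (cderiveM (Cinf_cderivable_y f z) (Cinf_cderivable_y g z)).2.
by rewrite /yline cplxE.
Qed.

Lemma Cinf_dx_is_linear : linear (@Cinf_dx R).
Proof.
move=> c f g; apply: CinfE => z /=.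
have [dc ec] := cderive_cst (c : C) (complex.Re z).
have [dcf ecf] := cderiveM dc (Cinf_cderivable_x f z).
have := (cderiveD dcf (Cinf_cderivable_x g z)).2.
by rewrite ecf ec mul0r add0r.
Qed.

Lemma Cinf_dy_is_linear : linear (@Cinf_dy R).
Proof.
move=> c f g; apply: CinfE => z /=.
have [dc ec] := cderive_cst (c : C) (complex.Im z).
have [dcf ecf] := cderiveM dc (Cinf_cderivable_y f z).
have := (cderiveD dcf (Cinf_cderivable_y g z)).2.
by rewrite ecf ec mul0r add0r.
Qed.

HB.instance Definition _ :=
  GRing.isLinear.Build R[i] Cinf Cinf _ (@Cinf_dx R) Cinf_dx_is_linear.
HB.instance Definition _ :=
  GRing.isLinear.Build R[i] Cinf Cinf _ (@Cinf_dy R) Cinf_dy_is_linear.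

Lemma Cinf_dx_conj f : Cinf_dx (Cinf_conj f) = Cinf_conj (Cinf_dx f).
Proof. by apply: CinfE => z; exact: (cderive_conj (Cinf_cderivable_x f z)).2. Qed.

Lemma Cinf_dy_conj f : Cinf_dy (Cinf_conj f) = Cinf_conj (Cinf_dy f).
Proof. by apply: CinfE => z; exact: (cderive_conj (Cinf_cderivable_y f z)).2. Qed.

Definition Cinf_dxdy (j k : nat) f : Cinf := iter j (@Cinf_dx R) (iter k (@Cinf_dy R) f).

Lemma Cinf_dxdyE j k f : Cinf_dxdy j k f = iter j (@dx R) (iter k (@dy R) f) :> (C -> C).
Proof.
rewrite /Cinf_dxdy; elim: j => [|j IH] /=; last by rewrite IH.
by elim: k => //= k ->.
Qed.

Lemma partialsE j k f : partials f (j, k) = Cinf_dxdy j k f :> (C -> C).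
Proof. by rewrite Cinf_dxdyE. Qed.

Lemma Cinf_dxdy_is_linear j k : linear (Cinf_dxdy j k).
Proof.
move=> c f g; rewrite /Cinf_dxdy.
have -> : iter k (@Cinf_dy R) (c *: f + g) = c *: iter k (@Cinf_dy R) f + iter k (@Cinf_dy R) g.
  by elim: k => //= k ->; rewrite linearP.
by elim: j => //= j ->; rewrite linearP.
Qed.

HB.instance Definition _ j k :=
  GRing.isLinear.Build R[i] Cinf Cinf _ (Cinf_dxdy j k) (Cinf_dxdy_is_linear j k).

Definition derivs_le (N : nat) (r M : R) f := forall j k z,
  (j <= N)%N -> (k <= N)%N -> csquare r z -> `|Cinf_dxdy j k f z : R[i]| <= M%:C.

Lemma derivs_leZ N r M f (c : R) : 0 <= c -> derivs_le N r M f ->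
  derivs_le N r (c * M) (c%:C *: f).
Proof.
move=> c0 H j k z jN kN rz; rewrite linearZ /=.
change (`|c%:C * Cinf_dxdy j k f z : R[i]| <= (c * M)%:C).
rewrite normrM rmorphM /= ger0_norm; last by rewrite lecR.
by apply: ler_wpM2l; [rewrite lecR | exact: H].
Qed.

Lemma derivs_leW N N' r r' M M' f : (N <= N')%N -> r <= r' -> M' <= M ->
  derivs_le N' r' M' f -> derivs_le N r M f.
Proof.
move=> NN rr MM H j k z jN kN [z1 z2].
apply: (@le_trans _ _ M'%:C); last by rewrite lecR.
apply: H; rewrite ?(leq_trans jN) ?(leq_trans kN) //.
by split; apply: le_trans rr.
Qed.

(** Continuity of a functional in the form in which it is used, with all partial
    derivatives of order at most [N] in each coordinate.  The bound [M] is positive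
    so that rescaling applies to it. *)
Definition finite_order (v : Cinf -> C) := exists N r (K : R), 0 < K /\
  forall f M, 0 < M -> derivs_le N r M f -> `|v f : R[i]| <= (K * M)%:C.

(** The sets [B n] of functions whose derivatives of order at most [n] are at
    most [1 / (n + 1)] on the square of size [n] generate a filter which converges
    to 0 in the topology of [Cinf]. *)
Lemma continuous_finite_order (u : {linear Cinf -> C}) :
  continuous u -> finite_order u.
Proof.
move=> cu; pose B n := [set f | derivs_le n n%:R (n.+1%:R^-1) f].
have BS m n : (m <= n)%N -> B n `<=` B m.
  move=> mn f; apply: derivs_leW; rewrite ?ler_nat // lef_pV2 ?posrE //.
  by rewrite ler_nat.
pose G : set_system Cinf := filter_from setT B.
have GF : Filter G.
  apply: filter_from_filter; first by exists 0%N.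
  move=> m n _ _; exists (maxn m n) => // f fB.
  by split; apply: BS fB; rewrite ?leq_maxl ?leq_maxr.
have G0 : G --> (0 : Cinf).
  (* It is enough to converge under the map that induces the topology. *)
  suff PG : @partials R @ G --> @partials R (0 : Cinf).
    move=> U [_ [[V oV <-] /= V0 VU]]; apply: filterS VU _.
    by apply: PG; rewrite nbhsE; exists V.
  apply/cvg_sup => -[j k] U [_ [[V oV <-] /= V0 VU]]; apply: filterS VU _.
  have : nbhs (partials (0 : Cinf) (j, k)) V by rewrite nbhsE; exists V.
  rewrite nbhs_filterE.
  suff : (fun f => partials f (j, k)) @ G --> partials (0 : Cinf) (j, k) by exact.
  apply/fam_cvgP => A cA P /uniform_nbhs [E [entE EP]].
  apply: filterS EP _.
  have [r rA] := compact_csquare cA.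
  move: entE; rewrite -entourage_ballE => -[e /= e0 eE].
  pose e1 := complex.Re e; have e1E : e = e1%:C.
    by move: e0; rewrite ltcE /= => /andP[/eqP ei _]; rewrite -{1}(cplxE e) ei.
  have e10 : 0 < e1 by rewrite -ltcR -e1E.
  pose n := (maxn (maxn j k) (maxn (Num.truncn `|r|).+1 (Num.truncn e1^-1).+1)).
  exists n => // f fB z Az; apply: eE; rewrite /= -ball_normE /ball_ /=.
  have p0 : partials (0 : Cinf) (j, k) z = 0.
    by rewrite partialsE linear0.
  rewrite p0 sub0r normrN partialsE.
  apply: (@le_lt_trans _ _ ((n.+1%:R)^-1%:C)).
    apply: fB; rewrite ?leq_max ?leqnn ?orbT //.
    have [z1 z2] := rA _ Az; have rn : r <= n%:R.
      apply: le_trans (ler_norm r) _; apply: (@le_trans _ _ (Num.truncn `|r|).+1%:R).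
        by apply/ltW/truncnS_gt.
      by rewrite ler_nat !leq_max leqnn !orbT.
    by split; apply: le_trans rn.
  rewrite e1E ltcR -[e1]invrK ltf_pV2 ?posrE ?invr_gt0 //.
  apply: (@lt_le_trans _ _ (Num.truncn e1^-1).+1%:R); first exact: truncnS_gt.
  by rewrite ler_nat (leq_trans _ (leqnSn _)) // !leq_max leqnn !orbT.
have /(_ _ (@nbhsx_ballx _ C (u 0) _ (@ltr01 R[i]))) : u @ G --> u 0.
  exact: cvg_comp G0 (cu 0).
move=> [n _ nP]; exists n, n%:R, n.+1%:R; split => // f M M0 fM.
have /= := nP ((M * n.+1%:R)^-1%:C *: f).
rewrite -ball_normE /ball_ /= raddf0 sub0r normrN linearZ /= => H.
have {H} /ltW : `|(M * n.+1%:R)^-1%:C * u f : R[i]| < 1.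
  have c0 : 0 <= (M * n.+1%:R)^-1 by rewrite invr_ge0 mulr_ge0 // ltW.
  apply: H; apply: derivs_leW (leqnn n) (lexx _) _ (derivs_leZ c0 fM).
  by rewrite invfM mulrAC mulVf ?mul1r // gt_eqF.
rewrite normrM [`|_%:C|]ger0_norm; last by rewrite lecR invr_ge0 mulr_ge0 // ltW.
rewrite (_ : (M * n.+1%:R)^-1%:C = ((M * n.+1%:R)%:C)^-1); last by rewrite fmorphV.
by rewrite ler_pdivrMl ?mulr1 ?(mulrC M) // ltcR mulr_gt0.
Qed.

End CinfOps.

(** * Mean values and symmetry of second derivatives *)

Section MeanValue.
Variable R : realType.
Local Notation C := (Cplx R).
Local Notation Cinf := (Cinf R).
Implicit Types (f g : Cinf).

Lemma is_derive_Re_x f (x y : R) : is_derive x (1 : R)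
  (fun t => complex.Re (f (t +i* y))) (complex.Re (Cinf_dx f (x +i* y))).
Proof.
have [dr _] := Cinf_cderivable_x f (x +i* y).
by rewrite [complex.Re (Cinf_dx _ _)]derive1E; exact: derivableP.
Qed.

Lemma is_derive_Re_y f (x y : R) : is_derive y (1 : R)
  (fun t => complex.Re (f (x +i* t))) (complex.Re (Cinf_dy f (x +i* y))).
Proof.
have [dr _] := Cinf_cderivable_y f (x +i* y).
by rewrite [complex.Re (Cinf_dy _ _)]derive1E; exact: derivableP.
Qed.

Lemma MVT_derive (F dF : R -> R) (a b : R) : a <= b ->
  (forall x, is_derive x (1 : R) F (dF x)) ->
  exists2 c, c \in `[a, b]%R & F b - F a = dF c * (b - a).
Proof.
move=> ab dFP; apply: MVT_segment => //.
by apply: derivable_within_continuous => x _; have [] := dFP x.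
Qed.

Lemma MVT_Re_x f (a b y : R) : a <= b -> exists2 c, c \in `[a, b]%R &
  complex.Re (f (b +i* y)) - complex.Re (f (a +i* y)) =
  complex.Re (Cinf_dx f (c +i* y)) * (b - a).
Proof. by move=> ab; exact: MVT_derive ab (fun x => is_derive_Re_x f x y). Qed.

Lemma ReB (v w : C) : complex.Re (v - w) = complex.Re v - complex.Re w.
Proof. by case: v w => [? ?] [? ?]. Qed.

Lemma ImB (v w : C) : complex.Im (v - w) = complex.Im v - complex.Im w.
Proof. by case: v w => [? ?] [? ?]. Qed.

Lemma Re_negi (w : C) : complex.Re (- 'i * w : R[i]) = complex.Im w.
Proof. by case: w => a b /=; rewrite !(oppr0, mul0r, mulN1r, opprK, sub0r, add0r). Qed.

(** The mean value theorem holds for the real and the imaginary part, at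
    different points, whence the factor 2. *)
Lemma lipschitz_x f (a b y M : R) :
  (forall c, c \in `[Num.min a b, Num.max a b]%R -> `|Cinf_dx f (c +i* y) : R[i]| <= M%:C) ->
  `|f (b +i* y) - f (a +i* y) : R[i]| <= (2 * M * `|b - a|)%:C.
Proof.
wlog ab : a b / a <= b.
  move=> H; case/orP: (le_total a b) => ab; first exact: H.
  by rewrite minC maxC distrC [`|b - a|]distrC; exact: H.
rewrite (min_idPl ab) (max_idPr ab) => H; rewrite (ger0_norm (_ : 0 <= b - a)) ?subr_ge0 //.
have HR (g : Cinf) : (forall c, c \in `[a, b]%R -> `|Cinf_dx g (c +i* y) : R[i]| <= M%:C) ->
    `|complex.Re (g (b +i* y)) - complex.Re (g (a +i* y))| <= M * (b - a).
  move=> gM; have [c cab ->] := MVT_Re_x g y ab.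
  rewrite normrM [`|b - a|]ger0_norm ?subr_ge0 // ler_wpM2r ?subr_ge0 //.
  by rewrite -lecR; apply: le_trans (normc_ge_Re _) (gM c cab).
apply: le_trans (normc_le_ReIm _) _; rewrite lecR ReB ImB.
have -> : 2 * M * (b - a) = M * (b - a) + M * (b - a) by ring.
apply: lerD; first exact: HR.
have := HR ((- 'i : R[i]) *: f); rewrite linearZ /= !Re_negi; apply.
move=> c cab; change (`|(- 'i) * Cinf_dx f (c +i* y) : R[i]| <= M%:C).
rewrite normrM normrN (_ : `|'i| = 1) ?mul1r; first exact: H.
by rewrite normc_def /= expr0n add0r expr1n sqrtr1.
Qed.

(** Both values are obtained from the same mixed second difference, by the mean
    value theorem in the two possible orders. *)
Lemma mixed_difference (F Fx Fy Fxy Fyx : R -> R -> R) (a b h : R) : 0 < h ->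
  (forall x y, is_derive x (1 : R) (F^~ y) (Fx x y)) ->
  (forall x y, is_derive y (1 : R) (F x) (Fy x y)) ->
  (forall x y, is_derive y (1 : R) (Fx x) (Fxy x y)) ->
  (forall x y, is_derive x (1 : R) (Fy^~ y) (Fyx x y)) ->
  exists p q : R * R, [/\ p.1 \in `[a, a + h]%R, p.2 \in `[b, b + h]%R,
    q.1 \in `[a, a + h]%R, q.2 \in `[b, b + h]%R & Fxy p.1 p.2 = Fyx q.1 q.2].
Proof.
move=> h0 dFx dFy dFxy dFyx.
have ah : a <= a + h by rewrite lerDl ltW.
have bh : b <= b + h by rewrite lerDl ltW.
have [x1 x1P E1] := MVT_derive ah (fun x => is_deriveB (dFx x (b + h)) (dFx x b)).
have [y1 y1P E1'] := MVT_derive bh (dFxy x1).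
have [y2 y2P E2] := MVT_derive bh (fun y => is_deriveB (dFy (a + h) y) (dFy a y)).
have [x2 x2P E2'] := MVT_derive ah (fun x => dFyx x y2).
exists (x1, y1), (x2, y2); split => //=.
have E1f : F (a + h) (b + h) - F (a + h) b - (F a (b + h) - F a b) =
  Fxy x1 y1 * (b + h - b) * (a + h - a) by rewrite -E1'; exact: E1.
have E2f : F (a + h) (b + h) - F a (b + h) - (F (a + h) b - F a b) =
  Fyx x2 y2 * (a + h - a) * (b + h - b) by rewrite -E2'; exact: E2.
have ha : a + h - a = h by rewrite addrAC subrr add0r.
have hb : b + h - b = h by rewrite addrAC subrr add0r.
have hn : h != 0 by rewrite gt_eqF.
apply: (mulIf hn); apply: (mulIf hn); move: E1f E2f; rewrite ha hb => <- <-.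
ring.
Qed.

Lemma quarterD_lt (t : R) : 0 < t -> t / 4 + t / 4 < t.
Proof. lra. Qed.

Lemma near_corner (F : C -> R) (a b d : R) : continuous F -> 0 < d ->
  exists2 e : R, 0 < e & forall x y, `|x - a| <= e -> `|y - b| <= e ->
    `|F (x +i* y) - F (a +i* b)| < d.
Proof.
move=> cF d0; have := cF (a +i* b).
move=> /(@cvgrPdist_lt R R C (nbhs (a +i* b : C)) _) /(_ _ d0) [e /= e0 eP].
have e1E : e = (complex.Re e)%:C.
  by move: e0; rewrite ltcE /= => /andP[/eqP ei _]; rewrite -{1}(cplxE e) ei.
have e10 : 0 < complex.Re e by rewrite -ltcR -e1E.
exists (complex.Re e / 4); first by rewrite divr_gt0.
move=> x y xe ye; rewrite distrC; apply: eP => /=.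
apply: le_lt_trans (normc_le_ReIm _) _; rewrite e1E ltcR ReB ImB /=.
rewrite distrC [`|b - y|]distrC.
exact: le_lt_trans (lerD xe ye) (quarterD_lt e10).
Qed.

Lemma eq_at_corner (F G : C -> R) (a b : R) : continuous F -> continuous G ->
  (forall h, 0 < h -> exists p q : R * R, [/\ p.1 \in `[a, a + h]%R,
    p.2 \in `[b, b + h]%R, q.1 \in `[a, a + h]%R, q.2 \in `[b, b + h]%R &
    F (p.1 +i* p.2) = G (q.1 +i* q.2)]) -> F (a +i* b) = G (a +i* b).
Proof.
move=> cF cG key; apply/eqP; rewrite -subr_eq0; apply/negPn/negP => ne0.
have d2 : 0 < `|F (a +i* b) - G (a +i* b)| / 2 by rewrite divr_gt0 // normr_gt0.
have [e1 e10 e1P] := near_corner a b cF d2.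
have [e2 e20 e2P] := near_corner a b cG d2.
have h0 : 0 < Num.min e1 e2 by rewrite lt_min e10.
have near_a (t c e : R) : Num.min e1 e2 <= e -> t \in `[c, c + Num.min e1 e2]%R -> `|t - c| <= e.
  move=> he; rewrite in_itv /= => /andP[t1 t2]; rewrite ger0_norm ?subr_ge0 //.
  by rewrite lerBlDl (le_trans t2) // lerD2l.
have m1 : Num.min e1 e2 <= e1 by rewrite ge_min lexx.
have m2 : Num.min e1 e2 <= e2 by rewrite ge_min lexx orbT.
have [p [q [p1 p2 q1 q2 pq]]] := key _ h0.
have A1 := e1P _ _ (near_a _ _ _ m1 p1) (near_a _ _ _ m1 p2).
have A2 := e2P _ _ (near_a _ _ _ m2 q1) (near_a _ _ _ m2 q2).
have : `|F (a +i* b) - G (a +i* b)| < `|F (a +i* b) - G (a +i* b)|.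
  rewrite [X in _ < X]splitr; apply: le_lt_trans (ltrD A1 A2); rewrite pq.
  rewrite [X in _ <= X + _]distrC; apply: le_trans (ler_normD _ _).
  by rewrite addrA subrK.
by rewrite ltxx.
Qed.

Lemma Re_Cinf_continuous f : continuous (fun z => complex.Re (f z)).
Proof.
by move=> z; exact: continuous_comp (@Cinf_continuous _ f z) (@Re_continuous _ (f z)).
Qed.

Lemma schwarz_Re f z :
  complex.Re (Cinf_dx (Cinf_dy f) z) = complex.Re (Cinf_dy (Cinf_dx f) z).
Proof.
case: z => a b; symmetry.
apply: (@eq_at_corner (fun z => complex.Re (Cinf_dy (Cinf_dx f) z))
  (fun z => complex.Re (Cinf_dx (Cinf_dy f) z)));
  [exact: Re_Cinf_continuous | exact: Re_Cinf_continuous | move=> h h0].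
exact: (mixed_difference a b h0 (is_derive_Re_x f) (is_derive_Re_y f)
  (is_derive_Re_y (Cinf_dx f)) (fun x y => is_derive_Re_x (Cinf_dy f) x y)).
Qed.

Lemma cplx_eq (v w : C) :
  complex.Re v = complex.Re w -> complex.Im v = complex.Im w -> v = w.
Proof. by case: v w => [? ?] [? ?] /= -> ->. Qed.

Lemma schwarz f : Cinf_dx (Cinf_dy f) = Cinf_dy (Cinf_dx f).
Proof.
apply: CinfE => z; apply: cplx_eq; first exact: schwarz_Re.
have := schwarz_Re ((- 'i : R[i]) *: f) z.
have -> : Cinf_dx (Cinf_dy (- 'i *: f)) = - 'i *: Cinf_dx (Cinf_dy f).
  by rewrite linearZ /= linearZ.
have -> : Cinf_dy (Cinf_dx (- 'i *: f)) = - 'i *: Cinf_dy (Cinf_dx f).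
  by rewrite linearZ /= linearZ.
by move=> H; rewrite -[LHS]Re_negi -[RHS]Re_negi; exact: H.
Qed.

Lemma Cinf_dxdy_dx j k f : Cinf_dxdy j k (Cinf_dx f) = Cinf_dxdy j.+1 k f.
Proof.
rewrite /Cinf_dxdy iterSr; congr (iter j _ _).
by elim: k => //= k ->; rewrite schwarz.
Qed.

Lemma Cinf_dxdy_dy j k f : Cinf_dxdy j k (Cinf_dy f) = Cinf_dxdy j k.+1 f.
Proof. by rewrite /Cinf_dxdy iterSr. Qed.

End MeanValue.

(** * Polynomials and their conjugates as smooth functions *)

Section Polynomials.
Variable R : realType.
Local Notation C := (Cplx R).
Local Notation Cinf := (Cinf R).
Implicit Types (P Q : {poly R[i]}) (c : R[i]).

Lemma cderiveP (h : R -> C) t (d : C) :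
  is_derive t (1 : R) (fun s => complex.Re (h s)) (complex.Re d) ->
  is_derive t (1 : R) (fun s => complex.Im (h s)) (complex.Im d) ->
  cderivable h t /\ cderive h t = d.
Proof.
move=> dr di; split; first by split; [case: dr | case: di].
by rewrite /cderive !derive1E !derive_val; case: (d).
Qed.

Lemma cderive_hline (y t : R) : cderivable (fun s => s +i* y : C) t /\
  cderive (fun s => s +i* y : C) t = 1.
Proof.
apply: cderiveP => /=; do ?[exact: is_derive_id | exact: is_derive_cst].
Qed.

Lemma cderive_vline (x t : R) : cderivable (fun s => x +i* s : C) t /\
  cderive (fun s => x +i* s : C) t = 'i.
Proof.
apply: cderiveP => /=; do ?[exact: is_derive_id | exact: is_derive_cst].
Qed.

Lemma dx_id : dx (fun z : C => z) = fun=> 1.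
Proof. by apply/funext => z; exact: (cderive_hline _ _).2. Qed.

Lemma dy_id : dy (fun z : C => z) = fun=> 'i.
Proof. by apply/funext => z; exact: (cderive_vline _ _).2. Qed.

Lemma smooth_id : smooth (fun z : C => z).
Proof.
have cid : continuous (fun z : C => z) by move=> z; exact: cvg_id.
case=> [|n]; first by split.
split => //; split; last by rewrite dy_id; exact: Cn_cst.
  by move=> z; split; [exact: (cderive_hline _ _).1 | exact: (cderive_vline _ _).1].
by rewrite dx_id; exact: Cn_cst.
Qed.

Lemma smooth_horner P : smooth (fun z : C => P.[z] : C).
Proof.
elim/poly_ind: P => [|P c IH] n.
  rewrite (_ : (fun _ => _) = fun=> 0); first exact: Cn_cst.
  by apply/funext => z; rewrite horner0.
rewrite (_ : (fun _ => _) = (fun z : C => P.[z] : C) * (fun z : C => z) + (fun=> c : C)).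
  by apply: CnD; [apply: CnM; [exact: IH | exact: smooth_id] | exact: Cn_cst].
by apply/funext => z; rewrite hornerMXaddC.
Qed.

Definition cpoly P : Cinf := to_Cinf (smooth_horner P).

Lemma cpoly_is_linear : linear cpoly.
Proof. by move=> c P Q; apply: CinfE => z; rewrite /= hornerD hornerZ. Qed.

HB.instance Definition _ :=
  GRing.isLinear.Build R[i] {poly R[i]} Cinf _ cpoly cpoly_is_linear.

Lemma cpolyM P Q : cpoly (P * Q) = Cinf_mul (cpoly P) (cpoly Q).
Proof. by apply: CinfE => z /=; rewrite hornerM. Qed.

Lemma dx_cpolyC c : Cinf_dx (cpoly c%:P) = 0.
Proof.
apply: CinfE => z; rewrite -[RHS](cderive_cst (c : C) (complex.Re z)).2 /=.
by rewrite /dx; congr (cderive _ _); apply/funext => t; rewrite /xline hornerC.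
Qed.

Lemma dy_cpolyC c : Cinf_dy (cpoly c%:P) = 0.
Proof.
apply: CinfE => z; rewrite -[RHS](cderive_cst (c : C) (complex.Im z)).2 /=.
by rewrite /dy; congr (cderive _ _); apply/funext => t; rewrite /yline hornerC.
Qed.

Lemma dx_cpolyX : Cinf_dx (cpoly 'X) = cpoly 1.
Proof.
apply: CinfE => z /=; rewrite (_ : (fun _ => _) = (fun z : C => z)); last first.
  by apply/funext => w; rewrite hornerX.
by rewrite dx_id hornerC.
Qed.

Lemma dy_cpolyX : Cinf_dy (cpoly 'X) = ('i : R[i]) *: cpoly 1.
Proof.
apply: CinfE => z /=; rewrite (_ : (fun _ => _) = (fun z : C => z)); last first.
  by apply/funext => w; rewrite hornerX.
rewrite dy_id; change ('i = 'i * (1 : {poly R[i]}).[z] :> R[i]).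
by rewrite hornerC mulr1.
Qed.

Lemma Cinf_mulZl c (f g : Cinf) : Cinf_mul (c *: f) g = c *: Cinf_mul f g.
Proof. by apply: CinfE => z; exact/esym/mulrA. Qed.

Lemma Cinf_mulDl (f g h : Cinf) : Cinf_mul (f + g) h = Cinf_mul f h + Cinf_mul g h.
Proof. by apply: CinfE => z; exact: mulrDl. Qed.

Lemma Cinf_mulC (f g : Cinf) : Cinf_mul f g = Cinf_mul g f.
Proof. by apply: CinfE => z; exact: mulrC. Qed.

Lemma Cinf_mulA (f g h : Cinf) : Cinf_mul f (Cinf_mul g h) = Cinf_mul (Cinf_mul f g) h.
Proof. by apply: CinfE => z; exact: mulrA. Qed.

Lemma Cinf_mul1 (f : Cinf) : Cinf_mul f (cpoly 1) = f.
Proof.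
apply: CinfE => z; change (f z * (1 : {poly R[i]}).[z] = f z :> R[i]).
by rewrite hornerC mulr1.
Qed.

Lemma Cinf_mulZr c (f g : Cinf) : Cinf_mul f (c *: g) = c *: Cinf_mul f g.
Proof. by rewrite !(Cinf_mulC f) Cinf_mulZl. Qed.

Lemma Cinf_mulDr (f g h : Cinf) : Cinf_mul f (g + h) = Cinf_mul f g + Cinf_mul f h.
Proof. by rewrite !(Cinf_mulC f) Cinf_mulDl. Qed.

Lemma Cinf_conjD (f g : Cinf) : Cinf_conj (f + g) = Cinf_conj f + Cinf_conj g.
Proof. by apply: CinfE => z; exact: rmorphD. Qed.

Lemma Cinf_conjZ c (f : Cinf) : Cinf_conj (c *: f) = c^*%C *: Cinf_conj f.
Proof. by apply: CinfE => z; exact: (rmorphM (@conjc R)). Qed.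

Lemma Cinf_conjM (f g : Cinf) : Cinf_conj (Cinf_mul f g) = Cinf_mul (Cinf_conj f) (Cinf_conj g).
Proof. by apply: CinfE => z; exact: (rmorphM (@conjc R)). Qed.

Lemma dx_cpoly P : Cinf_dx (cpoly P) = cpoly P^`().
Proof.
elim/poly_ind: P => [|P c IH]; first by rewrite deriv0 !linear0.
rewrite derivMXaddC !linearD /= !cpolyM Cinf_dxM IH dx_cpolyX dx_cpolyC addr0.
by rewrite Cinf_mul1 addrC.
Qed.

Lemma dy_cpoly P : Cinf_dy (cpoly P) = ('i : R[i]) *: cpoly P^`().
Proof.
elim/poly_ind: P => [|P c IH]; first by rewrite deriv0 !linear0.
rewrite derivMXaddC !linearD /= !cpolyM Cinf_dyM IH dy_cpolyX dy_cpolyC addr0.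
by rewrite Cinf_mulZl Cinf_mulZr Cinf_mul1 addrC.
Qed.

Definition cpair P Q : Cinf := Cinf_mul (cpoly P) (Cinf_conj (cpoly Q)).

Lemma cpairDl P1 P2 Q : cpair (P1 + P2) Q = cpair P1 Q + cpair P2 Q.
Proof. by rewrite /cpair linearD Cinf_mulDl. Qed.
Lemma cpairDr P Q1 Q2 : cpair P (Q1 + Q2) = cpair P Q1 + cpair P Q2.
Proof. by rewrite /cpair linearD Cinf_conjD Cinf_mulDr. Qed.
Lemma cpairZl c P Q : cpair (c *: P) Q = c *: cpair P Q.
Proof. by rewrite /cpair linearZ Cinf_mulZl. Qed.
Lemma cpairZr c P Q : cpair P (c *: Q) = c^*%C *: cpair P Q.
Proof. by rewrite /cpair linearZ Cinf_conjZ Cinf_mulZr. Qed.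

Lemma dx_cpair P Q :
  Cinf_dx (cpair P Q) = (1 : R[i]) *: cpair P^`() Q + (1 : R[i]) *: cpair P Q^`().
Proof. by rewrite !scale1r /cpair Cinf_dxM Cinf_dx_conj !dx_cpoly. Qed.

Lemma dy_cpair P Q : Cinf_dy (cpair P Q) =
  ('i : R[i]) *: cpair P^`() Q + (- 'i : R[i]) *: cpair P Q^`().
Proof.
rewrite /cpair Cinf_dyM Cinf_dy_conj !dy_cpoly Cinf_mulZl Cinf_conjZ Cinf_mulZr.
congr (_ + _ *: _); apply/eqP; rewrite eq_complex /= oppr0.
by apply/andP; split.
Qed.

Lemma cpoly_entire P : entire (cpoly P).
Proof.
move=> z; elim/poly_ind: P => [|P c IH].
  rewrite (_ : cinf_fun _ = fun=> 0); first exact: derivable_cst.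
  by apply/funext => w; rewrite /= horner0.
rewrite (_ : cinf_fun _ = (cpoly P : C -> C) * (fun z : C => z) + (fun=> c : C)).
  apply: derivableD; last exact: derivable_cst.
  by apply: derivableM; [exact: IH | exact: derivable_id].
by apply/funext => w; rewrite /= hornerMXaddC.
Qed.

End Polynomials.

(** * Derivatives of truncated exponentials *)

Section Slices.
Variable R : realType.
Local Notation C := (Cplx R).
Local Notation Cinf := (Cinf R).
Implicit Types (f g : {poly R[i]}) (a s : R[i]).

(** The Taylor polynomial of degree [n] of [exp (s (X - a))]. *)
Definition texp (n : nat) (s a : R[i]) : {poly R[i]} :=
  \sum_(i < n.+1) (s ^+ i / i`!%:R) *: ('X - a%:P) ^+ i.

Lemma texp_deriv n s a : (texp n.+1 s a)^`() = s *: texp n s a.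
Proof.
rewrite /texp big_ord_recl /= derivD expr0 linearZ /= derivC scaler0 add0r.
rewrite raddf_sum scaler_sumr; apply: eq_bigr => i _.
rewrite [LHS]derivZ deriv_exp derivB derivX derivC subr0 mul1r /bump leq0n add1n /=.
rewrite -[_ ^+ i *+ _]scaler_nat !scalerA; congr (_ *: _).
rewrite factS natrM invfM -mulrA mulrAC mulVf ?pnatr_eq0 // mul1r.
by rewrite exprS mulrA.
Qed.

Lemma texp_bound a (r rho : R) : 0 <= rho ->
  exists n0, forall n1 n2 s z, (n0 <= n1)%N -> (n0 <= n2)%N -> `|s| <= rho%:C ->
  csquare r z -> `|(texp n1 s a).[z] * (texp n2 (- s) a).[z] : R[i]| <= 2.
Proof.
move=> rho0.
have [B B0 BP] := csquare_bound r (@Cinf_continuous _ (cpoly ('X - a%:P))).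
have [n0 n0P] := truncated_exp_bound (mulr_ge0 rho0 (ltW B0)).
exists n0 => n1 n2 s z n01 n02 srho rz.
have E n t : (texp n t a).[z] = \sum_(i < n.+1) (t * (z - a)) ^+ i / i`!%:R.
  rewrite /texp horner_sum; apply: eq_bigr => i _.
  by rewrite hornerZ horner_exp hornerXsubC exprMn mulrAC.
rewrite !E mulNr; apply: n0P => //.
rewrite normrM rmorphM ler_pM ?normr_ge0 //.
by have := BP z rz; rewrite /= hornerXsubC.
Qed.

(** Polynomial growth in [|s|] of an operator applied to
    [f E_s conj (g E_(-s))]; the exponent [m] counts derivatives, and must not
    depend on [f] and [g]. *)
Definition slice_bounded (T : Cinf -> Cinf) (m : nat) := forall f g a (r : R),
  exists2 K : R, 0 < K & forall rho : R, 0 <= rho -> exists n0, forall n1 n2 s z,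
    (n0 <= n1)%N -> (n0 <= n2)%N -> `|s| <= rho%:C -> csquare r z ->
    `|T (cpair (f * texp n1 s a) (g * texp n2 (- s) a)) z : R[i]|
      <= (K * (1 + rho) ^+ m)%:C.

Lemma slice_bounded_id : slice_bounded id 0.
Proof.
move=> f g a r.
have [A A0 AP] := csquare_bound r (@Cinf_continuous _ (cpoly f)).
have [B B0 BP] := csquare_bound r (@Cinf_continuous _ (cpoly g)).
exists (A * B * 2); first by rewrite !mulr_gt0.
move=> rho rho0; have [n0 n0P] := texp_bound a r rho0.
exists n0 => n1 n2 s z n01 n02 srho rz; rewrite expr0 mulr1.
change (`|(f * texp n1 s a).[z] * (g * texp n2 (- s) a).[z]^*%C| <= (A * B * 2)%:C).
rewrite !hornerM normrM normcJ -normrM mulrACA normrM rmorphM ler_pM ?normr_ge0 //.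
  by rewrite normrM rmorphM ler_pM ?normr_ge0 ?AP ?BP.
by rewrite rmorph_nat; exact: n0P.
Qed.

(** By the Leibniz rule the derivative is a sum of four terms of the same kind, in
    which [f] or [g] is differentiated or a factor [s] appears and one of the
    truncations drops by one degree. *)
Lemma slice_bounded_step (T D : Cinf -> Cinf) (m : nat) (c1 c2 : R[i]) :
  linear T -> `|c1| <= 1 -> `|c2| <= 1 ->
  (forall P Q, D (cpair P Q) = c1 *: cpair P^`() Q + c2 *: cpair P Q^`()) ->
  slice_bounded T m -> slice_bounded (fun phi => T (D phi)) m.+1.
Proof.
move=> Tlin c1b c2b DE IH f g a r.
have [K1 K10 K1P] := IH f^`() g a r; have [K2 K20 K2P] := IH f g a r.
have [K3 K30 K3P] := IH f g^`() a r.
exists (K1 + K2 + (K3 + K2)); first by rewrite !addr_gt0.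
move=> rho rho0; have [n1 n1P] := K1P _ rho0; have [n2 n2P] := K2P _ rho0.
have [n3 n3P] := K3P _ rho0.
(* The degrees are successors, so that they can drop by one. *)
exists (maxn n1 (maxn n2 n3)).+1 => -[//|N1] [//|N2] s z.
rewrite !ltnS !geq_max => /andP[a1 /andP[a2 a3]] /andP[b1 /andP[b2 b3]] srho rz.
have T0 : T 0 = 0.
  by have := Tlin 1 0 0; rewrite !scale1r addr0 -[LHS]addr0 => /addrI/esym.
have TZ c phi : T (c *: phi) = c *: T phi.
  by rewrite -[_ *: phi]addr0 Tlin T0 addr0.
have {}DE P Q : T (D (cpair P Q)) z = c1 * T (cpair P^`() Q) z + c2 * T (cpair P Q^`()) z :> R[i].
  by rewrite DE Tlin TZ.
have TD P1 P2 Q (c : R[i]) : T (cpair (P1 + c *: P2) Q) z =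
    T (cpair P1 Q) z + c * T (cpair P2 Q) z :> R[i].
  by rewrite addrC cpairDl cpairZl Tlin addrC.
have TD' P Q1 Q2 (c : R[i]) : T (cpair P (Q1 + c *: Q2)) z =
    T (cpair P Q1) z + c^*%C * T (cpair P Q2) z :> R[i].
  by rewrite addrC cpairDr cpairZr Tlin addrC.
rewrite DE !derivM !texp_deriv -!scalerAr TD TD'.
have X1 := n1P N1.+1 N2.+1 s z (leqW a1) (leqW b1) srho rz.
have X2 := n2P N1 N2.+1 s z a2 (leqW b2) srho rz.
have X3 := n3P N1.+1 N2.+1 s z (leqW a3) (leqW b3) srho rz.
have X4 := n2P N1.+1 N2 s z (leqW a2) b2 srho rz.
have rho1 : 0 <= (1 + rho) ^+ m by rewrite exprn_ge0 // addr_ge0.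
have fin (c x y t : R[i]) (K K' : R) : 0 <= K -> 0 <= K' -> `|c| <= 1 -> `|t| <= rho%:C ->
  `|x| <= (K * (1 + rho) ^+ m)%:C -> `|y| <= (K' * (1 + rho) ^+ m)%:C ->
  `|c * (x + t * y)| <= ((K + K') * (1 + rho) ^+ m.+1)%:C.
  move=> K0 K'0 c1' tr xK yK; rewrite normrM -[leRHS]mul1r; apply: ler_pM => //.
  apply: le_trans (ler_normD _ _) _; rewrite normrM.
  apply: (@le_trans _ _ ((K * (1 + rho) ^+ m)%:C + rho%:C * (K' * (1 + rho) ^+ m)%:C)).
    by apply: lerD => //; apply: ler_pM.
  rewrite -rmorphM -rmorphD lecR exprS -subr_ge0.
  set w := _ ^+ m in rho1 *.
  rewrite (_ : _ - _ = K * rho * w + K' * w); last by ring.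
  by rewrite addr_ge0 ?mulr_ge0.
rewrite [(K1 + K2 + _) * _]mulrDl rmorphD.
apply: le_trans (ler_normD _ _) _; apply: lerD; apply: fin => //; try exact: ltW.
by rewrite normcJ normrN.
Qed.

Lemma normc_i : `|'i : R[i]| = 1.
Proof. by rewrite normc_def /= expr0n add0r expr1n sqrtr1. Qed.

(** Symmetry of second derivatives allows the innermost derivative to be taken in
    either coordinate. *)
Lemma slice_bounded_dxdy j k : slice_bounded (Cinf_dxdy j k) (j + k).
Proof.
have n1 : `|1 : R[i]| <= 1 by rewrite normr1.
have ni : `|'i : R[i]| <= 1 by rewrite normc_i.
have nNi : `|- 'i : R[i]| <= 1 by rewrite normrN normc_i.
elim: j => [|j IH].
  elim: k => [|k IH]; first exact: slice_bounded_id.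
  have := slice_bounded_step (@Cinf_dxdy_is_linear R 0 k) ni nNi (@dy_cpair R) IH.
  move=> H f g a r; have [K K0 KP] := H f g a r; exists K => // rho rho0.
  have [n0 n0P] := KP rho rho0; exists n0 => N1 N2 s z h1 h2 h3 h4.
  by have := n0P N1 N2 s z h1 h2 h3 h4; rewrite Cinf_dxdy_dy.
have := slice_bounded_step (@Cinf_dxdy_is_linear R j k) n1 n1 (@dx_cpair R) IH.
move=> H f g a r; have [K K0 KP] := H f g a r; exists K => // rho rho0.
have [n0 n0P] := KP rho rho0; exists n0 => N1 N2 s z h1 h2 h3 h4.
by have := n0P N1 N2 s z h1 h2 h3 h4; rewrite Cinf_dxdy_dx.
Qed.

End Slices.

(** * Moments of a weakly multiplicative distribution *)

Section Slice.
Variable R : realType.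
Local Notation C := (Cplx R).
Local Notation Cinf := (Cinf R).
Implicit Types (f g P Q : {poly R[i]}) (a s : R[i]).
Variable u : {linear Cinf -> C}.

Definition hol_moment P : R[i] := u (cpoly P).
(** The conjugation makes it linear. *)
Definition antihol_moment Q : R[i] := (u (Cinf_conj (cpoly Q)))^*%C.

Lemma hol_moment_is_scalar : scalar hol_moment.
Proof. by move=> c P Q; rewrite /hol_moment !linearP. Qed.

Lemma antihol_moment_is_scalar : scalar antihol_moment.
Proof.
move=> c P Q; rewrite /antihol_moment linearP Cinf_conjD Cinf_conjZ linearP.
rewrite [LHS]rmorphD; congr (_ + _).
rewrite [LHS](rmorphM (@conjc R) c^*%C); congr (_ * _); exact: conjcK.
Qed.

HB.instance Definition _ := GRing.isLinear.Build R[i] {poly R[i]} R[i] *%R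
  hol_moment hol_moment_is_scalar.
HB.instance Definition _ := GRing.isLinear.Build R[i] {poly R[i]} R[i] *%R
  antihol_moment antihol_moment_is_scalar.

Lemma WM_cpair : weakly_multiplicative u -> forall P Q,
  u (cpair P Q) = hol_moment P * (antihol_moment Q)^*%C.
Proof.
move=> wm P Q; rewrite /cpair wm; try exact: cpoly_entire.
by congr (_ * _); exact/esym/conjcK.
Qed.

(** The order of [u] bounds the number of derivatives, hence the exponent,
    uniformly in [f], [g] and [a]. *)
Lemma order_slice N r (K0 : R) : 0 < K0 ->
  (forall phi M, 0 < M -> derivs_le N r M phi -> `|u phi : R[i]| <= (K0 * M)%:C) ->
  forall f g a, exists2 K : R, 0 < K & forall rho : R, 0 <= rho ->
    exists n0, forall n1 n2 s, (n0 <= n1)%N -> (n0 <= n2)%N -> `|s| <= rho%:C ->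
    `|u (cpair (f * texp n1 s a) (g * texp n2 (- s) a)) : R[i]|
      <= (K * (1 + rho) ^+ (N + N))%:C.
Proof.
move=> K00 uK f g a.
(* The constants depend on the derivative; there are finitely many. *)
have /choice[K KP] jk : exists K : R, 0 < K /\ forall rho : R, 0 <= rho ->
    exists n0, forall n1 n2 s z, (n0 <= n1)%N -> (n0 <= n2)%N ->
    `|s| <= rho%:C -> csquare r z ->
    `|Cinf_dxdy jk.1 jk.2 (cpair (f * texp n1 s a) (g * texp n2 (- s) a)) z : R[i]|
      <= (K * (1 + rho) ^+ (jk.1 + jk.2))%:C.
  by have [K KK KP] := slice_bounded_dxdy jk.1 jk.2 f g a r; exists K.
pose S := \sum_(j < N.+1) \sum_(k < N.+1) K (j : nat, k : nat).
have KS j k : (j <= N)%N -> (k <= N)%N -> K (j, k) <= S.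
  move=> jN kN; have Kge0 jk : 0 <= K jk by apply: ltW; exact: (KP jk).1.
  rewrite /S (bigD1 (inord j)) //= (bigD1 (inord k)) //= !inordK // -addrA lerDl.
  by rewrite addr_ge0 ?sumr_ge0 // => i _; rewrite ?sumr_ge0.
have S0 : 0 < S by apply: lt_le_trans (KS 0 0 _ _)%N => //; exact: (KP _).1.
exists (K0 * S); first by rewrite mulr_gt0.
move=> rho rho0.
have /choice[n0 n0P] jk : exists n0, forall n1 n2 s z, (n0 <= n1)%N -> (n0 <= n2)%N ->
    `|s| <= rho%:C -> csquare r z ->
    `|Cinf_dxdy jk.1 jk.2 (cpair (f * texp n1 s a) (g * texp n2 (- s) a)) z : R[i]|
      <= (K jk * (1 + rho) ^+ (jk.1 + jk.2))%:C.
  exact: (KP jk).2.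
exists (\max_(j < N.+1) \max_(k < N.+1) n0 (j : nat, k : nat))%N => n1 n2 s h1 h2 srho.
rewrite -mulrA; apply: uK; first by rewrite mulr_gt0 ?exprn_gt0 // ltr_pwDl.
move=> j k z jN kN rz.
have n0le : (n0 (j, k) <= \max_(j < N.+1) \max_(k < N.+1) n0 (j : nat, k : nat))%N.
  have := @leq_bigmax _ (fun j : 'I_N.+1 => \max_(k < N.+1) n0 (j : nat, k : nat)) (inord j).
  apply: leq_trans; rewrite inordK //.
  by have := @leq_bigmax _ (fun k : 'I_N.+1 => n0 (j : nat, k : nat)) (inord k); rewrite inordK.
apply: le_trans (n0P (j, k) n1 n2 s z (leq_trans n0le h1) (leq_trans n0le h2) srho rz) _.
rewrite lecR ler_pM ?exprn_ge0 ?KS ?addr_ge0 //; first by rewrite ltW // (KP _).1.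
by rewrite ler_weXn2l ?lerDl // leq_add.
Qed.

(** The coefficient of degree [l] of the polynomials in [s] obtained from the
    truncations is [moment_product] as soon as the truncation degree reaches [l],
    and a coefficient of degree larger than the growth exponent vanishes. *)
Lemma moment_product_vanishes : finite_order u -> weakly_multiplicative u ->
  exists D, forall f g a l, (D < l)%N ->
    moment_product hol_moment antihol_moment f g a l = 0.
Proof.
move=> [N [r [K0 [K00 uK]]]] wm; exists (N + N)%N => f g a l Nl.
have [K KK KP] := order_slice K00 uK f g a.
apply: (polynomial_growth Nl (C := K%:C)); first by rewrite ler0c ltW.
move=> t t1; have t0 : 0 < t by apply: lt_le_trans t1.
have tE : t = (complex.Re t)%:C.
  by move: t0; rewrite ltcE /= => /andP[/eqP ti _]; rewrite -{1}(cplxE t) ti.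
set rho := complex.Re t in tE; have rho0 : 0 <= rho by rewrite -ler0c -tE ltW.
have [n0 n0P] := KP _ rho0; pose n := maxn n0 l.
pose A := \poly_(i < n.+1) (hol_moment (f * ('X - a%:P) ^+ i) / i`!%:R).
pose B := \poly_(j < n.+1) ((-1) ^+ j * antihol_moment (g * ('X - a%:P) ^+ j) / j`!%:R).
have -> : moment_product hol_moment antihol_moment f g a l = (A * B)`_l.
  rewrite coefM; apply: eq_bigr => i _; have il : (i <= l)%N by rewrite -ltnS.
  rewrite !coef_poly !ltnS (leq_trans il (leq_maxr _ _)).
  by rewrite (leq_trans (leq_subr _ _) (leq_maxr _ _)).
apply: cauchy_estimate => // s st.
have As : A.[s] = hol_moment (f * texp n s a).
  rewrite horner_poly /texp mulr_sumr linear_sum; apply: eq_bigr => i _.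
  by rewrite -scalerAr linearZ /= mulrC mulrCA mulrC.
have Bs : B.[s] = antihol_moment (g * texp n (- s) a).
  rewrite horner_poly /texp mulr_sumr linear_sum; apply: eq_bigr => i _.
  rewrite -scalerAr linearZ /= (exprNn s).
  rewrite [RHS]mulrC; ring.
rewrite hornerM As Bs normrM -(normcJ (antihol_moment _)) -normrM -WM_cpair //.
have n0n : (n0 <= n)%N by rewrite leq_maxl.
have := n0P n n s n0n n0n; rewrite st -tE => /(_ (lexx _)).
by rewrite rmorphM rmorphXn rmorphD rmorph1 /= -tE.
Qed.

Lemma WM_moments_vanish : finite_order u -> weakly_multiplicative u ->
  hol_moment 1 = 1 -> exists (a : R[i]) (D : nat), forall l, (D < l)%N ->
  hol_moment (('X - a%:P) ^+ l) = 0 /\ antihol_moment (('X - a%:P) ^+ l) = 0.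
Proof.
move=> uo wm h1; have [D DP] := moment_product_vanishes uo wm.
apply: (@moments_vanish _ hol_moment antihol_moment h1 _ D) => //.
have /eqP := WM_cpair wm 1 1; rewrite h1 mul1r.
have -> : u (cpair 1 1) = 1 :> R[i].
  rewrite -h1 /hol_moment; congr (u _); apply: CinfE => z.
  change ((1 : {poly R[i]}).[z] * ((1 : {poly R[i]}).[z])^*%C = (1 : {poly R[i]}).[z]).
  by rewrite hornerC rmorph1 mulr1.
by rewrite eq_sym -(inj_eq (can_inj (@conjcK R))) conjcK rmorph1 => /eqP.
Qed.

End Slice.

(** * Functions of one real coordinate *)

Section Pullbacks.
Variable R : realType.
Local Notation C := (Cplx R).
Local Notation Cinf := (Cinf R).
Implicit Types (f g : Cinf) (p q : {poly R[i]}).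

Lemma pair_continuous (a b : C -> R) : continuous a -> continuous b ->
  continuous (fun z => a z +i* b z : C).
Proof.
move=> ca cb z.
have cab : (fun z => (a z, b z)) @ (nbhs z) --> (a z, b z).
  exact: cvg_pair (ca z) (cb z).
exact: (cvg_comp _ _ cab (@cplx_continuous R (a z, b z))).
Qed.

Definition on_vline (c : R) (f : C -> C) : C -> C := fun z => f (c +i* complex.Im z).
Definition on_swap (f : C -> C) : C -> C := fun z => f (complex.Im z +i* complex.Re z).

Lemma Cn_on_vline n c (f : C -> C) : Cn n f -> Cn n (on_vline c f).
Proof.
have cont (h : C -> C) : continuous h -> continuous (on_vline c h).
  move=> ch z; have cc : continuous (fun _ : C => c) by exact: cst_continuous.
  have cp := pair_continuous cc (@Im_continuous R).
  exact: (@continuous_comp _ _ _ _ h z (cp z) (ch _)).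
elim: n f => [|n IH] f [cf]; first by split; first exact: cont.
move=> [df fx fy]; split; first exact: cont.
split.
- move=> z; split.
    exact: (cderive_cst (f (c +i* complex.Im z)) (complex.Re z)).1.
  exact: (df (c +i* complex.Im z)).2.
- rewrite (_ : dx _ = fun=> 0); first exact: Cn_cst.
  apply/funext => z.
  exact: (cderive_cst (f (c +i* complex.Im z)) (complex.Re z)).2.
- exact: (IH _ fy).
Qed.

Lemma Cn_on_swap n (f : C -> C) : Cn n f -> Cn n (on_swap f).
Proof.
have cont (h : C -> C) : continuous h -> continuous (on_swap h).
  move=> ch z; have cp := pair_continuous (@Im_continuous R) (@Re_continuous R).
  exact: (@continuous_comp _ _ _ _ h z (cp z) (ch _)).
elim: n f => [|n IH] f [cf]; first by split; first exact: cont.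
move=> [df fx fy]; split; first exact: cont.
split.
- move=> z; split; first exact: (df (complex.Im z +i* complex.Re z)).2.
  exact: (df (complex.Im z +i* complex.Re z)).1.
- exact: (IH _ fy).
- exact: (IH _ fx).
Qed.

(** Smooth functions of [y] alone are represented as restrictions to a vertical
    line. *)
Definition vrestr (c : R) f : Cinf := to_Cinf (fun n => Cn_on_vline c (CinfP f n)).
Definition swap f : Cinf := to_Cinf (fun n => Cn_on_swap (CinfP f n)).

Lemma vrestr_is_linear c : linear (vrestr c).
Proof. by move=> k f g; apply: CinfE => z. Qed.
Lemma swap_is_linear : linear swap.
Proof. by move=> k f g; apply: CinfE => z. Qed.
HB.instance Definition _ c :=
  GRing.isLinear.Build R[i] Cinf Cinf _ (vrestr c) (vrestr_is_linear c).
HB.instance Definition _ := GRing.isLinear.Build R[i] Cinf Cinf _ swap swap_is_linear.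

Lemma swapK : involutive swap.
Proof. by move=> f; apply: CinfE => -[x y]. Qed.

Lemma dx_swap f : Cinf_dx (swap f) = swap (Cinf_dy f).
Proof. by apply: CinfE. Qed.
Lemma dy_swap f : Cinf_dy (swap f) = swap (Cinf_dx f).
Proof. by apply: CinfE. Qed.
Lemma dx_vrestr c f : Cinf_dx (vrestr c f) = 0.
Proof. 
apply: CinfE => z.
exact: (cderive_cst (f (c +i* complex.Im z)) (complex.Re z)).2.
Qed.
Lemma dy_vrestr c f : Cinf_dy (vrestr c f) = vrestr c (Cinf_dy f).
Proof. by apply: CinfE. Qed.
(** Built from [cpoly] by coordinate changes, so that smoothness and derivatives
    are inherited. *)
Definition xpoly p : Cinf := swap (vrestr 0 (swap (cpoly p))).

Lemma dx_xpoly p : Cinf_dx (xpoly p) = xpoly p^`().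
Proof. by rewrite /xpoly dx_swap dy_vrestr dy_swap dx_cpoly. Qed.
Lemma dy_xpoly p : Cinf_dy (xpoly p) = 0.
Proof. by rewrite /xpoly dy_swap dx_vrestr linear0. Qed.

Lemma Cinf_mul0 f : Cinf_mul f 0 = 0.
Proof. by apply: CinfE => z; exact: mulr0. Qed.
Lemma Cinf_0mul f : Cinf_mul 0 f = 0.
Proof. by rewrite Cinf_mulC Cinf_mul0. Qed.

Definition xtens p f : Cinf := Cinf_mul (xpoly p) (vrestr 0 f).

Lemma xtensE p f z : xtens p f z = p.[(complex.Re z)%:C] * f (0 +i* complex.Im z) :> R[i].
Proof. by []. Qed.

Lemma dx_xtens p f : Cinf_dx (xtens p f) = xtens p^`() f.
Proof. by rewrite /xtens Cinf_dxM dx_xpoly dx_vrestr Cinf_mul0 addr0. Qed.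
Lemma dy_xtens p f : Cinf_dy (xtens p f) = xtens p (Cinf_dy f).
Proof. by rewrite /xtens Cinf_dyM dy_xpoly dy_vrestr Cinf_0mul add0r. Qed.

Lemma xtens_dxdy j k p f :
  Cinf_dxdy j k (xtens p f) = xtens p^`(j) (Cinf_dxdy 0 k f).
Proof.
have -> : Cinf_dxdy j k (xtens p f) = Cinf_dxdy j 0 (xtens p (Cinf_dxdy 0 k f)).
  rewrite /Cinf_dxdy /=; congr (iter j _ _); elim: k => //= k ->.
  by rewrite dy_xtens.
rewrite /Cinf_dxdy /=; elim: j => [|j IH]; first by [].
by rewrite /= IH dx_xtens.
Qed.

End Pullbacks.

(** * Bernstein approximation in one coordinate *)

Section Approximation.
Variable R : realType.
Local Notation C := (Cplx R).
Local Notation Cinf := (Cinf R).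
Implicit Types (f g F : Cinf) (p q : {poly R[i]}) (s : seq ({poly R[i]} * Cinf)).

Definition xspan s : Cinf := \sum_(c <- s) xtens c.1 c.2.

Lemma poly_primitive p : exists P, P^`() = p.
Proof.
exists (\poly_(i < (size p).+1) (p`_i.-1 / i%:R)); apply/polyP => i.
rewrite coef_deriv coef_poly ltnS /= -[_ *+ i.+1]mulr_natr.
case: ltnP => [_|/(nth_default 0) ->]; last by rewrite mul0r.
by rewrite divfK ?pnatr_eq0.
Qed.

Lemma xspan_primitive s : exists S, Cinf_dx (xspan S) = xspan s.
Proof.
elim: s => [|[p f] s [S SE]].
  by exists [::]; rewrite /xspan !big_nil linear0.
have [P PE] := poly_primitive p; exists ((P, f) :: S).
rewrite /xspan !big_cons [LHS]linearD; congr (_ + _); last exact: SE.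
by rewrite [LHS]dx_xtens PE.
Qed.

Lemma xtens1 f : xtens 1 f = vrestr 0 f.
Proof.
apply: CinfE => z.
change ((1 : {poly R[i]}).[(complex.Re z)%:C] * vrestr 0 f z =
  vrestr 0 f z :> R[i]).
by rewrite hornerC mul1r.
Qed.

Lemma bernstein_horner (r x : R) n i : 0 < r ->
  (bernstein ((2 * r)^-1%:C *: ('X + (r%:C)%:P)) n i).[x%:C] =
  (bernstein ((x + r) / (2 * r)) n i)%:C.
Proof.
move=> r0; rewrite -[LHS]/(horner_eval x%:C _) bernstein_rmorph.
rewrite (bernstein_rmorph (real_complex R)).
congr (bernstein _ _ _).
rewrite [LHS]/= /horner_eval hornerZ hornerD hornerX hornerC.
by rewrite rmorphM rmorphD mulrC.
Qed.

Lemma sum_cinf (I : Type) (l : seq I) (h : I -> Cinf) z :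
  (\sum_(i <- l) h i) z = \sum_(i <- l) (h i z : R[i]) :> R[i].
Proof. by elim: l => [|i l IH]; rewrite ?big_nil // !big_cons -IH. Qed.

(** Only [x] is moved, so that a bound on the [x]-derivative and the mean
    deviation of the nodes suffice. *)
Lemma bernstein_approx f (r L : R) (m : nat) z : 0 < r -> (0 < m)%N ->
  (forall w, csquare r w -> `|Cinf_dx f w : R[i]| <= L%:C) -> csquare r z ->
  `|f z - \sum_(i < (m ^ 2).+1)
     (bernstein ((complex.Re z + r) / (2 * r)) (m ^ 2) i)%:C *
     f ((2 * r * (i%:R / (m ^ 2)%:R) - r) +i* complex.Im z) : R[i]| <= (8 * L * r / m%:R)%:C.
Proof.
move=> r0 m0 fL [zx zy]; set x := complex.Re z in zx *; set y := complex.Im z in zy *.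
set n := (m ^ 2)%N; set t := (x + r) / (2 * r).
have r20 : 0 < 2 * r by rewrite mulr_gt0.
have /andP[xl xu] : - r <= x <= r by rewrite -ler_norml.
have t0 : 0 <= t.
  by rewrite divr_ge0 // ?(ltW r20) // -lerBlDr sub0r.
have t1 : t <= 1 by rewrite ler_pdivrMr // mul1r mulr2n mulrDl mul1r lerD2r.
have n0 : 0 < n%:R :> R by rewrite ltr0n expn_gt0 m0.
have xE : x = 2 * r * t - r by rewrite mulrC divfK ?gt_eqF // addrK.
have L0 : 0 <= L.
  rewrite -ler0c; apply: le_trans (fL (0 +i* 0) _); first exact: normr_ge0.
  by split; rewrite /= normr0 ltW.
have fzE : f z = \sum_(i < n.+1) (bernstein t n i)%:C * f z :> R[i].
  by rewrite -mulr_suml -rmorph_sum bernstein_sum1 rmorph1 mul1r.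
rewrite [X in `|X - _|]fzE -sumrB.
apply: le_trans (ler_norm_sum _ _ _) _.
apply: (@le_trans _ _ (\sum_(i < n.+1) (bernstein t n i * `|t - i%:R / n%:R| * (4 * L * r))%:C)).
  apply: ler_sum => i _; rewrite -mulrBr normrM -[_ * _ * (4 * L * r)]mulrA [leRHS]rmorphM.
  have b0 : 0 <= (bernstein t n i)%:C by rewrite ler0c bernstein_ge0.
  rewrite (ger0_norm b0); apply: ler_wpM2l b0 _ _ _.
  have i0 : 0 <= i%:R / n%:R :> R by rewrite divr_ge0 ?ler0n.
  have i1 : i%:R / n%:R <= 1 :> R by rewrite ler_pdivrMr // mul1r ler_nat -ltnS.
  set xi := 2 * r * (i%:R / n%:R) - r.
  have xil : - r <= xi by rewrite /xi lerBrDr addNr mulr_ge0 // ltW.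
  have xiu : xi <= r by rewrite /xi lerBlDr (_ : r + r = 2 * r) ?ler_piMr // ?(ltW r20) //; ring.
  have := @lipschitz_x _ f xi x y L; rewrite [x +i* y]cplxE => lip.
  apply: le_trans (lip _) _.
    move=> c; rewrite in_itv /= => /andP[c1 c2]; apply: fL; split => //=.
    rewrite ler_norml (le_trans _ c1) ?le_min ?xil ?xl //=.
    by rewrite (le_trans c2) // ge_max xiu.
  rewrite lecR {1}xE /xi opprB addrA subrK -mulrBr normrM (gtr0_norm r20).
  by rewrite le_eqVlt; apply/orP; left; apply/eqP; ring.
rewrite -rmorph_sum lecR -mulr_suml.
apply: le_trans (ler_wpM2r _ (bernstein_deviation t0 t1 m0)) _.
  by rewrite !mulr_ge0 // ltW.
by rewrite le_eqVlt; apply/orP; left; apply/eqP; ring.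
Qed.

End Approximation.

(** * Approximation of all derivatives *)

Section DerivativeApproximation.
Variable R : realType.
Local Notation C := (Cplx R).
Local Notation Cinf := (Cinf R).
Implicit Types (f g F : Cinf) (p q : {poly R[i]}) (s : seq ({poly R[i]} * Cinf)).

(** Bernstein approximation in [x] commutes with derivatives in [y]. *)
Lemma x_approx0 F K (r e : R) : 0 < r -> 0 < e ->
  exists s, forall k z, (k <= K)%N -> csquare r z ->
    `|Cinf_dxdy 0 k (F - xspan s) z : R[i]| <= e%:C.
Proof.
move=> r0 e0.
have /choice[L LP] k : exists L : R, 0 < L /\
    forall w, csquare r w -> `|Cinf_dx (Cinf_dxdy 0 k F) w : R[i]| <= L%:C.
  have [L L0 LP] := csquare_bound r (@Cinf_continuous _ (Cinf_dx (Cinf_dxdy 0 k F))).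
  by exists L.
pose S := \sum_(k < K.+1) L k.
have LS k : (k <= K)%N -> L k <= S.
  move=> kK; rewrite /S (bigD1 (inord k)) //= inordK // lerDl.
  by rewrite sumr_ge0 // => i _; apply: ltW; exact: (LP i).1.
have S0 : 0 < S by apply: lt_le_trans (LP 0%N).1 (LS 0%N _).
(* [bernstein_approx] yields the error [8 S r / m]. *)
pose m := (Num.truncn (8 * S * r / e)).+1; pose n := (m ^ 2)%N.
pose b i := bernstein ((2 * r)^-1%:C *: ('X + (r%:C)%:P)) n i.
pose x i := 2 * r * (i%:R / n%:R) - r.
exists [seq (b i, vrestr (x i) F) | i <- index_iota 0 n.+1] => k z kK rz.
have E : Cinf_dxdy 0 k (F - xspan [seq (b i, vrestr (x i) F) | i <- index_iota 0 n.+1]) z =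
   Cinf_dxdy 0 k F z - \sum_(i < n.+1) (bernstein ((complex.Re z + r) / (2 * r)) n i)%:C *
     Cinf_dxdy 0 k F (x i +i* complex.Im z) :> R[i].
  rewrite [Cinf_dxdy _ _ _]linearB; congr (_ - _).
  rewrite /xspan big_map big_mkord (linear_sum (Cinf_dxdy 0 k)).
  rewrite [LHS]sum_cinf.
  apply: eq_bigr => i _; have xE := xtens_dxdy 0 k (b i) (vrestr (x i) F).
  rewrite [LHS](congr1 (fun h : Cinf => h z) xE).
  rewrite xtensE bernstein_horner //.
  congr (_ * _); have -> : Cinf_dxdy 0 k (vrestr (x i) F) = vrestr (x i) (Cinf_dxdy 0 k F).
    by rewrite /Cinf_dxdy /=; elim: k {kK xE} => //= k ->; rewrite dy_vrestr.
  by [].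
have fL w : csquare r w -> `|Cinf_dx (Cinf_dxdy 0 k F) w : R[i]| <= S%:C.
  by move=> rw; apply: le_trans ((LP k).2 w rw) _; rewrite lecR LS.
rewrite E; apply: le_trans (bernstein_approx r0 (ltn0Sn _) fL rz) _.
rewrite lecR ler_pdivrMr ?ltr0n // -ler_pdivrMl // mulrC; apply: ltW; exact: truncnS_gt.
Qed.

(** Induction on the order in [x]: approximate the [x]-derivative, integrate the
    approximation in [x], and correct it by its error on the line [x = 0], which
    is a function of [y]. *)
Lemma x_approx J F K (r e : R) : 0 < r -> 0 < e ->
  exists s, forall j k z, (j <= J)%N -> (k <= K)%N -> csquare r z ->
    `|Cinf_dxdy j k (F - xspan s) z : R[i]| <= e%:C.
Proof.
elim: J F e => [|J IH] F e r0 e0.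
  by have [s sP] := x_approx0 F K r0 e0; exists s => -[|//] k z _; exact: sP.
(* The factor [2 * r] pays for the integration over [0, x], and 1 for the
   derivatives of positive order in [x]. *)
pose e' := e / (1 + 2 * r).
have d0 : 0 < 1 + 2 * r by rewrite addr_gt0 // mulr_gt0.
have e'0 : 0 < e' by rewrite divr_gt0.
have e'e : e' <= e.
  by rewrite ler_pdivrMr // ler_peMr ?(ltW e0) // lerDl mulr_ge0 // ltW.
have e're : 2 * e' * r <= e.
  rewrite (_ : 2 * e' * r = e * (2 * r) / (1 + 2 * r)); last by rewrite /e'; ring.
  by rewrite ler_pdivrMr // ler_pM2l // lerDr ler01.
have [s sP] := IH (Cinf_dx F) e' r0 e'0.
have [S SE] := xspan_primitive s.
pose G : Cinf := F - xspan S.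
exists ((1, G) :: S) => j k z jJ kK rz.
have -> : F - xspan ((1, G) :: S) = G - vrestr 0 G.
  by rewrite /xspan big_cons -/(xspan S) /= xtens1 [_ + xspan S]addrC opprD addrA.
have dxG : Cinf_dx (G - vrestr 0 G) = Cinf_dx F - xspan s.
  rewrite [LHS]linearB [X in _ - X]dx_vrestr subr0 /G [LHS]linearB.
  by congr (_ - _).
case: j jJ => [_|j jJ]; last first.
  rewrite -Cinf_dxdy_dx dxG; apply: le_trans (sP _ _ _ jJ kK rz) _.
  by rewrite lecR.
have [zx zy] := rz.
pose H := Cinf_dxdy 0 k (G - vrestr 0 G).
have H0 : H (0 +i* complex.Im z) = 0.
  have -> : H = Cinf_dxdy 0 k G - vrestr 0 (Cinf_dxdy 0 k G).
    rewrite /H [LHS]linearB; congr (_ - _).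
    by rewrite /Cinf_dxdy /=; elim: k {kK H} => //= k ->; rewrite dy_vrestr.
  exact: subrr.
have := @lipschitz_x _ H 0 (complex.Re z) (complex.Im z) e'.
rewrite cplxE H0 !subr0 => lip; apply: le_trans (lip _) _.
  move=> c cI.
  have /andP[c1 c2] : Num.min 0 (complex.Re z) <= c <= Num.max 0 (complex.Re z).
    by move: cI; rewrite in_itv.
  have -> : Cinf_dx H = Cinf_dxdy 0 k (Cinf_dx F - xspan s) by rewrite -dxG Cinf_dxdy_dx.
  apply: sP => //; split => //=.
  move: zx; rewrite !ler_norml => /andP[x1 x2].
  rewrite (le_trans _ c1) ?le_min ?x1 ?oppr_le0 ?(ltW r0) //=.
  by rewrite (le_trans c2) // ge_max x2 (ltW r0).
rewrite lecR; apply: le_trans e're.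
by apply: ler_wpM2l zx; rewrite mulr_ge0 // ltW.
Qed.

Lemma lec_small (w : R[i]) (c : R) : 0 < c ->
  (forall e : R, 0 < e -> `|w| <= (c * e)%:C) -> w = 0.
Proof.
move=> c0 H; apply/eqP/negPn/negP => w0.
have nw : 0 < `|w| by rewrite normr_gt0.
have wE : `|w| = (complex.Re `|w|)%:C by rewrite RRe_real // normr_real.
have t0 : 0 < complex.Re `|w| by rewrite -ltcR -wE.
set t := complex.Re _ in wE t0.
have := H (t / (2 * c)) (divr_gt0 t0 (mulr_gt0 (ltr0Sn R 1) c0)).
rewrite wE lecR (_ : c * _ = t / 2); last by field; rewrite gt_eqF.
by rewrite ler_pdivlMr // ger_pMr // leNgt ltr1n.
Qed.

(** This needs [v] on products of a polynomial in [x] with an arbitrary function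
    of [y]; a second application in the other coordinate reaches polynomials. *)
Lemma x_density (v : {linear Cinf -> C}) : finite_order v ->
  (forall p f, v (xtens p f) = 0) -> forall f, v f = 0.
Proof.
move=> [N [r [K [K0 vK]]]] v0 f.
apply: (@lec_small (v f) K K0) => e e0.
have r'0 : 0 < `|r| + 1 by rewrite ltr_wpDl.
have [s sP] := x_approx N f N r'0 e0.
have -> : v f = v (f - xspan s).
  rewrite linearB /xspan linear_sum big1 ?subr0 // => c _; exact: v0.
apply: vK => // j k z jN kN [zx zy]; apply: sP => //.
by split; apply: le_trans (zx) _ || apply: le_trans (zy) _; rewrite ler_wpDr // ler_norm.
Qed.

End DerivativeApproximation.

(** * Density of polynomials *)

Section Density.
Variable R : realType.
Local Notation C := (Cplx R).
Local Notation Cinf := (Cinf R).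
Implicit Types (f g F phi psi : Cinf) (p q P Q : {poly R[i]}).

Definition ypoly q : Cinf := swap (xpoly q).

Lemma cpairM P1 Q1 P Q :
  Cinf_mul (cpair P1 Q1) (cpair P Q) = cpair (P1 * P) (Q1 * Q).
Proof.
rewrite /cpair !cpolyM Cinf_conjM !Cinf_mulA; congr Cinf_mul.
by rewrite -!Cinf_mulA; congr Cinf_mul; rewrite Cinf_mulC.
Qed.

Lemma xpolyX : xpoly 'X = (2 : R[i])^-1 *: (cpair 'X 1 + cpair 1 'X).
Proof.
apply: CinfE => z.
change (('X : {poly R[i]}).[(complex.Re z)%:C] = (2 : R[i])^-1 *
  ((('X : {poly R[i]}).[z] * (1 : {poly R[i]}).[z]^*%C) +
   ((1 : {poly R[i]}).[z] * ('X : {poly R[i]}).[z]^*%C))).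
by rewrite !hornerX !hornerC rmorph1 mulr1 mul1r addcJ mulKf // pnatr_eq0.
Qed.

Lemma ypolyX : ypoly 'X = (2 * 'i : R[i])^-1 *: (cpair 'X 1 - cpair 1 'X).
Proof.
apply: CinfE => z.
change (('X : {poly R[i]}).[(complex.Im z)%:C] = (2 * 'i : R[i])^-1 *
  ((('X : {poly R[i]}).[z] * (1 : {poly R[i]}).[z]^*%C) -
   ((1 : {poly R[i]}).[z] * ('X : {poly R[i]}).[z]^*%C))).
rewrite !hornerX !hornerC rmorph1 mulr1 mul1r subcJ mulrAC mulKf //.
rewrite mulf_neq0 ?pnatr_eq0 //; apply/eqP => /(congr1 (@complex.Im R)) /eqP.
by rewrite oner_eq0.
Qed.

Lemma xpolyMXaddC p (c : R[i]) :
  xpoly (p * 'X + c%:P) = Cinf_mul (xpoly 'X) (xpoly p) + c *: cpoly 1.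
Proof.
apply: CinfE => z.
change ((p * 'X + c%:P).[(complex.Re z)%:C] =
  ('X : {poly R[i]}).[(complex.Re z)%:C] * p.[(complex.Re z)%:C]
  + c * (1 : {poly R[i]}).[z]).
by rewrite hornerMXaddC hornerX hornerC mulr1 mulrC.
Qed.

Lemma ypolyMXaddC p (c : R[i]) :
  ypoly (p * 'X + c%:P) = Cinf_mul (ypoly 'X) (ypoly p) + c *: cpoly 1.
Proof.
apply: CinfE => z.
change ((p * 'X + c%:P).[(complex.Im z)%:C] =
  ('X : {poly R[i]}).[(complex.Im z)%:C] * p.[(complex.Im z)%:C]
  + c * (1 : {poly R[i]}).[z]).
by rewrite hornerMXaddC hornerX hornerC mulr1 mulrC.
Qed.

Section Vanishing.
Variable v : {linear Cinf -> C}.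
Hypothesis v0 : forall P Q, v (cpair P Q) = 0.

Let kills phi := forall P Q, v (Cinf_mul phi (cpair P Q)) = 0.

Let killsD (c : R[i]) phi psi : kills phi -> kills psi -> kills (phi + c *: psi).
Proof.
move=> h1 h2 P Q; rewrite Cinf_mulDl Cinf_mulZl linearD linearZ h1 h2 /=.
by rewrite scaler0 addr0.
Qed.

Let killsZ (c : R[i]) phi : kills phi -> kills (c *: phi).
Proof. by move=> h P Q; rewrite Cinf_mulZl linearZ h /= scaler0. Qed.

Let kills_cpair phi P Q : kills phi -> kills (Cinf_mul (cpair P Q) phi).
Proof.
move=> h P' Q'; rewrite (Cinf_mulC _ phi) -Cinf_mulA cpairM; exact: h.
Qed.

Let kills_x phi : kills phi -> kills (Cinf_mul (xpoly 'X) phi).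
Proof.
move=> h; rewrite xpolyX Cinf_mulZl; apply: killsZ.
rewrite Cinf_mulDl -[X in kills (_ + X)]scale1r.
by apply: killsD; exact: kills_cpair.
Qed.

Let kills_y phi : kills phi -> kills (Cinf_mul (ypoly 'X) phi).
Proof.
move=> h; rewrite ypolyX Cinf_mulZl; apply: killsZ.
rewrite -scaleN1r Cinf_mulDl Cinf_mulZl.
by apply: killsD; exact: kills_cpair.
Qed.

Let kills1 : kills (cpoly 1).
Proof. by move=> P Q; rewrite Cinf_mulC Cinf_mul1. Qed.

(** As [x] and [y] are combinations of [z] and its conjugate, the functions whose
    products with all [cpair P Q] are annihilated are stable under multiplication
    by [x] and [y]. *)
Lemma kills_xy_polynomials p q : v (Cinf_mul (xpoly p) (ypoly q)) = 0.
Proof.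
have one f : Cinf_mul (cpoly 1) f = f by rewrite Cinf_mulC Cinf_mul1.
have ky : kills (ypoly q).
  elim/poly_ind: q => [|q c IH]; last first.
    by rewrite ypolyMXaddC; apply: killsD; [exact: kills_y | exact: kills1].
  have := killsZ 0 kills1; rewrite scale0r; congr kills.
  by apply: CinfE => z; rewrite /ypoly; symmetry; exact: horner0.
have kxy : kills (Cinf_mul (xpoly p) (ypoly q)).
  elim/poly_ind: p => [|p c IH]; last first.
    rewrite xpolyMXaddC Cinf_mulDl Cinf_mulZl one -Cinf_mulA.
    by apply: killsD; [exact: kills_x | exact: ky].
  have := killsZ 0 kills1; rewrite scale0r; congr kills.
  by rewrite (_ : xpoly 0 = 0) ?Cinf_0mul //; apply: CinfE => z; exact: horner0.
have := kxy 1 1; congr (v _ = 0); rewrite -[RHS]Cinf_mul1; congr Cinf_mul.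
rewrite /cpair one; apply: CinfE => z.
change ((1 : {poly R[i]}).[z]^*%C = (1 : {poly R[i]}).[z]).
by rewrite hornerC rmorph1.
Qed.

End Vanishing.

Lemma xtens_linear p : linear (xtens p).
Proof. by move=> c f g; rewrite /xtens linearP Cinf_mulDr Cinf_mulZr. Qed.

Lemma dxdy_swap k f : Cinf_dxdy 0 k (swap f) = swap (Cinf_dxdy k 0 f).
Proof. by rewrite /Cinf_dxdy /=; elim: k => //= k ->; rewrite dy_swap. Qed.

(** The swap turns derivatives in [y] of the second factor into derivatives in
    [x] of [f]. *)
Lemma finite_order_xtens (v w : {linear Cinf -> C}) p :
  (forall f, w f = v (xtens p (swap f))) -> finite_order v -> finite_order w.
Proof.
move=> wE [N [r [K [K0 vK]]]].
have /choice[B BP] j : exists B : R, 0 < B /\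
    forall z, csquare r z -> `|xpoly p^`(j) z : R[i]| <= B%:C.
  have [B B0 BP] := csquare_bound r (@Cinf_continuous _ (xpoly p^`(j))).
  by exists B.
pose S := \sum_(j < N.+1) B j.
have BS j : (j <= N)%N -> B j <= S.
  move=> jN; rewrite /S (bigD1 (inord j)) //= inordK // lerDl.
  by rewrite sumr_ge0 // => i _; apply: ltW; exact: (BP i).1.
have S0 : 0 < S by apply: lt_le_trans (BP 0%N).1 (BS 0%N _).
exists N, r, (K * S); split; first exact: mulr_gt0.
move=> f M M0 fM; rewrite wE -mulrA; apply: vK; first exact: mulr_gt0.
move=> j k z jN kN rz; rewrite xtens_dxdy xtensE dxdy_swap normrM rmorphM.
apply: ler_pM; rewrite ?normr_ge0 //.
  by apply: le_trans ((BP j).2 z rz) _; rewrite lecR BS.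
have [zx zy] := rz; apply: (fM k 0%N (complex.Im z +i* 0)) => //.
by split; rewrite //= normr0 (le_trans (normr_ge0 _) zx).
Qed.

(** [f |-> v (xtens p (swap f))] depends only on the restriction of [f] to the real
    axis, so its values on [xtens q f] only involve polynomials in [x] and [y].
    By [x_density] it vanishes, and then so does [v]. *)
Theorem polynomials_dense (v : {linear Cinf -> C}) : finite_order v ->
  (forall P Q, v (cpair P Q) = 0) -> forall f, v f = 0.
Proof.
move=> vo v0; apply: (x_density vo) => p g.
pose w0 f := v (xtens p (swap f)).
have w0_linear : linear w0.
  by move=> c f h; rewrite /w0 linearP xtens_linear linearP.
pose w : {linear Cinf -> C} := HB.pack w0 (GRing.isLinear.Build _ _ _ _ w0 w0_linear).
have wo : finite_order w by apply: (@finite_order_xtens v w p _ vo).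
have := x_density wo _ (swap g); rewrite /w /= /w0 swapK; apply => q f.
have -> : xtens p (swap (xtens q f)) = (f 0 : R[i]) *: Cinf_mul (xpoly p) (ypoly q).
  apply: CinfE => z.
  change (p.[(complex.Re z)%:C] * (q.[(complex.Im z)%:C] * f 0) =
    f 0 * (p.[(complex.Re z)%:C] * q.[(complex.Im z)%:C]) :> R[i]).
  by rewrite mulrA mulrC.
by rewrite linearZ kills_xy_polynomials //= scaler0.
Qed.

End Density.

(** * Cauchy-Riemann equations *)

Section CauchyRiemann.
Variable R : realType.
Local Notation C := (Cplx R).
Local Notation Cinf := (Cinf R).
Implicit Types (f g phi psi : Cinf) (p q P Q : {poly R[i]}).

Lemma cvg_eqfun (T : topologicalType) (G : set_system R) (F1 F2 : R -> T) (l : T) :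
  F1 =1 F2 -> F1 @ G --> l -> F2 @ G --> l.
Proof. by move=> /funext ->. Qed.

Lemma real_line_dnbhs (c : R[i]) : c != 0 ->
  (fun h : R => h%:C * c : C) @ 0^' --> (0 : C)^'.
Proof.
move=> c0 A; rewrite /dnbhs /within /= => -[e /= e0 eA].
have nc : 0 < `|c| by rewrite normr_gt0.
have ce0 : 0 < e / `|c| by rewrite divr_gt0.
have eE : e / `|c| = (complex.Re (e / `|c|))%:C.
  by rewrite RRe_real // gtr0_real.
set d := complex.Re _ in eE; have d0 : 0 < d by rewrite -ltcR -eE.
exists d => //= h; rewrite /ball_ /= sub0r normrN => hd h0; apply: eA => /=.
  rewrite sub0r normrN normrM -ltr_pdivlMr // eE.
  by rewrite normc_def /= expr0n addr0 sqrtr_sqr ltcR.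
by rewrite mulf_neq0 // fmorph_eq0.
Qed.

(** Complex differentiability restricted to the real line through [z] in the
    direction [c]. *)
Lemma entire_directional (f : C -> C) z (c : R[i]) : c != 0 -> derivable f z 1 ->
  (fun h : R => (h^-1)%:C * (f (h%:C * c + z) - f z) : C) @ 0^' -->
    (c * 'D_1 f z : C).
Proof.
move=> c0 df.
have H : (fun h : C => h^-1 *: (f (h *: 1 + z) - f z)) @ 0^' --> ('D_1 f z : C) by exact: df.
have H1 := cvg_comp _ _ (real_line_dnbhs c0) H.
have H2 := cvgM (cvg_cst (c : C)) H1.
apply: (@cvg_eqfun C _ _ _ _ _ (H2 _ _)) => h.
change (c * ((h%:C * c)^-1 * (f ((h%:C * c) * 1 + z) - f z)) =
  (h^-1)%:C * (f (h%:C * c + z) - f z) :> R[i]).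
by rewrite mulr1 mulrA; congr (_ * _); rewrite invfM mulrCA mulfV ?mulr1 ?fmorphV.
Qed.

Lemma cvg_Re (F : R -> C) (G : set_system R) {FG : Filter G} (l : C) :
  F @ G --> l -> (fun h => complex.Re (F h)) @ G --> complex.Re l.
Proof. by move=> H; exact: (cvg_comp _ _ H (@Re_continuous R l)). Qed.

Lemma cvg_Im (F : R -> C) (G : set_system R) {FG : Filter G} (l : C) :
  F @ G --> l -> (fun h => complex.Im (F h)) @ G --> complex.Im l.
Proof. by move=> H; exact: (cvg_comp _ _ H (@Im_continuous R l)). Qed.

Lemma cderive_directional (g : R -> C) (t : R) (d : C) :
  (fun h : R => (h^-1)%:C * (g (h + t) - g t) : C) @ 0^' --> d ->
  cderive g t = d.
Proof.
move=> H; rewrite /cderive !derive1E.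
have -> : 'D_1 (fun s => complex.Re (g s)) t = complex.Re d.
  apply: cvg_lim => //; apply: (@cvg_eqfun R _ _ _ _ _ (cvg_Re H)) => h.
  change ((complex.Re ((h^-1)%:C * (g (h + t) - g t))) =
    h^-1 * (complex.Re (g (h * 1 + t)) - complex.Re (g t))).
  rewrite mulr1; case: (g (h + t)) (g t) => [a b] [a' b'] /=.
  by rewrite mul0r subr0.
have -> : 'D_1 (fun s => complex.Im (g s)) t = complex.Im d.
  apply: cvg_lim => //; apply: (@cvg_eqfun R _ _ _ _ _ (cvg_Im H)) => h.
  change ((complex.Im ((h^-1)%:C * (g (h + t) - g t))) =
    h^-1 * (complex.Im (g (h * 1 + t)) - complex.Im (g t))).
  rewrite mulr1; case: (g (h + t)) (g t) => [a b] [a' b'] /=.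
  by rewrite mul0r addr0.
by case: (d).
Qed.

Lemma entire_dx f z : entire f -> Cinf_dx f z = 'D_1 f z.
Proof.
move=> fe; apply: cderive_directional.
have := entire_directional (oner_neq0 R[i]) (fe z); rewrite mul1r.
apply: (@cvg_eqfun C) => h.
rewrite /xline cplxE mulr1; congr (_ * (f _ - _)).
by apply: cplx_eq; case: (z) => a b //=; rewrite add0r.
Qed.

Lemma entire_dy f z : entire f -> Cinf_dy f z = 'i * 'D_1 f z.
Proof.
move=> fe; apply: cderive_directional.
have i0 : 'i != 0 :> R[i] by rewrite eq_complex /= oner_eq0 andbF.
have := entire_directional i0 (fe z).
apply: (@cvg_eqfun C) => h.
rewrite /yline cplxE; congr (_ * (f _ - _)).
apply: cplx_eq; case: (z) => a b /=.
  by rewrite mulr0 mul0r subr0 add0r.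
by rewrite mulr1 mulr0 addr0.
Qed.

Lemma delbar_entire f : entire f -> delbar f = 0.
Proof.
move=> fe; apply: CinfE => z.
change ((2%:R : R[i])^-1 * (Cinf_dx f z + 'i * Cinf_dy f z) = 0 :> R[i]).
by rewrite entire_dx // entire_dy // mulrA -expr2 sqr_i mulN1r subrr mulr0.
Qed.

End CauchyRiemann.

(** * Wirtinger derivatives of products *)

Section WirtingerAlgebra.
Variable K : comNzRingType.
Implicit Types (h i a b c d : K).

Lemma wirtinger_linear h i k a b c d :
  h * (k * a + b + i * (k * c + d)) = k * (h * (a + i * c)) + h * (b + i * d).
Proof. ring. Qed.

Lemma wirtinger_comm h i a b c :
  h * (h * (a + - i * b) + i * (h * (b + - i * c))) =
  h * (h * (a + i * b) - i * (h * (b + i * c))).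
Proof. ring. Qed.

Lemma wirtinger_leibniz h i a b fx gx fy gy :
  h * (fx * b + a * gx + i * (fy * b + a * gy)) =
  h * (fx + i * fy) * b + a * (h * (gx + i * gy)).
Proof. ring. Qed.

End WirtingerAlgebra.

Section Wirtinger.
Variable R : realType.
Local Notation C := (Cplx R).
Local Notation Cinf := (Cinf R).
Implicit Types (f g phi psi : Cinf) (p q P Q : {poly R[i]}).

(** The common form of [del] and [delbar], for [- i] and [i]. *)
Definition wirtinger (i : R[i]) f : Cinf :=
  (2%:R : R[i])^-1 *: (Cinf_dx f + i *: Cinf_dy f).

Lemma delE f : del f = wirtinger (- 'i) f.
Proof. by rewrite /wirtinger scaleNr. Qed.

Lemma wirtinger_is_linear i : linear (wirtinger i).
Proof.
move=> c f g; apply: CinfE => z.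
rewrite /wirtinger Cinf_dx_is_linear Cinf_dy_is_linear.
exact: (wirtinger_linear 2%:R^-1 i c (Cinf_dx f z) (Cinf_dx g z)
  (Cinf_dy f z) (Cinf_dy g z)).
Qed.

Lemma del_is_linear : linear (@del R).
Proof. by move=> c f g; rewrite !delE wirtinger_is_linear. Qed.

Lemma delbar_is_linear : linear (@delbar R).
Proof. exact: wirtinger_is_linear. Qed.

HB.instance Definition _ := GRing.isLinear.Build R[i] Cinf Cinf _ (@del R) del_is_linear.
HB.instance Definition _ := GRing.isLinear.Build R[i] Cinf Cinf _ (@delbar R) delbar_is_linear.

Lemma delbar_del f : delbar (del f) = del (delbar f).
Proof.
have dxE (h k : Cinf) (c : R[i]) : Cinf_dx (2%:R^-1 *: (h + c *: k)) =
    (2%:R : R[i])^-1 *: (Cinf_dx h + c *: Cinf_dx k).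
  by rewrite linearZ /= linearD /= linearZ.
have dyE (h k : Cinf) (c : R[i]) : Cinf_dy (2%:R^-1 *: (h + c *: k)) =
    (2%:R : R[i])^-1 *: (Cinf_dy h + c *: Cinf_dy k).
  by rewrite linearZ /= linearD /= linearZ.
apply: CinfE => z; rewrite /delbar /del -scaleNr !dxE !dyE schwarz.
exact: (wirtinger_comm (2%:R^-1 : R[i]) 'i (Cinf_dx (Cinf_dx f) z)
  (Cinf_dy (Cinf_dx f) z) (Cinf_dy (Cinf_dy f) z)).
Qed.

Lemma wirtingerM i f g :
  wirtinger i (Cinf_mul f g) = Cinf_mul (wirtinger i f) g + Cinf_mul f (wirtinger i g).
Proof.
apply: CinfE => z; rewrite /wirtinger Cinf_dxM Cinf_dyM.
exact: (wirtinger_leibniz 2%:R^-1 i (f z) (g z) (Cinf_dx f z) (Cinf_dx g z)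
  (Cinf_dy f z) (Cinf_dy g z)).
Qed.

Lemma delM f g : del (Cinf_mul f g) = Cinf_mul (del f) g + Cinf_mul f (del g).
Proof. by rewrite !delE wirtingerM. Qed.

Lemma delbarM f g : delbar (Cinf_mul f g) = Cinf_mul (delbar f) g + Cinf_mul f (delbar g).
Proof. exact: wirtingerM. Qed.

Lemma conj_i : ('i : R[i])^*%C = - 'i.
Proof. by apply/eqP; rewrite eq_complex /= oppr0 !eqxx. Qed.

Lemma conj_half : ((2%:R : R[i])^-1)^*%C = 2%:R^-1.
Proof. by rewrite fmorphV rmorph_nat. Qed.

Lemma wirtinger_conj i f : Cinf_conj (wirtinger i f) = wirtinger i^*%C (Cinf_conj f).
Proof.
rewrite /wirtinger Cinf_dx_conj Cinf_dy_conj Cinf_conjZ Cinf_conjD Cinf_conjZ.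
by congr (_ *: _); exact: conj_half.
Qed.

Lemma del_conj f : del (Cinf_conj f) = Cinf_conj (delbar f).
Proof.
rewrite delE [RHS]wirtinger_conj; congr (wirtinger _ _).
by apply/esym; exact: conj_i.
Qed.

Lemma delbar_conj f : delbar (Cinf_conj f) = Cinf_conj (del f).
Proof.
have conjK g : Cinf_conj (Cinf_conj g) = g by apply: CinfE => z; exact: conjcK.
by rewrite -[LHS]conjK -del_conj conjK.
Qed.

Lemma del_cpoly P : del (cpoly P) = cpoly P^`().
Proof.
rewrite /del dx_cpoly dy_cpoly; apply: CinfE => z; set d := cpoly P^`().
change (2%:R^-1 * (d z - 'i * ('i * d z)) = d z :> R[i]).
rewrite mulrA -expr2 sqr_i mulN1r opprK -[_ + _](mulr_natl (d z) 2).
by rewrite mulKf ?pnatr_eq0.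
Qed.

Lemma delbar_iter_del k f : delbar f = 0 -> delbar (iter k (@del R) f) = 0.
Proof. by move=> f0; elim: k => [|k IH] //=; rewrite delbar_del IH linear0. Qed.

(** [del] does not see [conj g] as [delbar g = 0], and [delbar] does not see the
    [del]-derivatives of [f] because the two operators commute. *)
Lemma wirtinger_mul k l f g : delbar f = 0 -> delbar g = 0 ->
  iter l (@delbar R) (iter k (@del R) (Cinf_mul f (Cinf_conj g))) =
  Cinf_mul (iter k (@del R) f) (Cinf_conj (iter l (@del R) g)).
Proof.
move=> f0 g0.
have conj0 : Cinf_conj (0 : Cinf) = 0 by apply: CinfE => z; exact: (rmorph0 (@conjc R)).
have -> : iter k (@del R) (Cinf_mul f (Cinf_conj g)) = Cinf_mul (iter k (@del R) f) (Cinf_conj g).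
  elim: k => [|k IH] //=.
  by rewrite IH delM del_conj g0 conj0 Cinf_mul0 addr0.
have := delbar_iter_del k f0; move: (iter k _ f) => h h0.
elim: l => [|l IH] //=.
by rewrite IH delbarM h0 Cinf_0mul add0r delbar_conj.
Qed.

Lemma iter_del_cpoly k P : iter k (@del R) (cpoly P) = cpoly P^`(k).
Proof. by elim: k => [|k IH] //=; rewrite IH del_cpoly. Qed.

End Wirtinger.

(** * Point distributions *)

Section Jets.
Variable K : numFieldType.
Implicit Types (P Q : {poly K}) (a : K).

Lemma derivn_XsubC_exp a m k :
  (('X - a%:P) ^+ m)^`(k) = ('X - a%:P) ^+ (m - k) *+ (m ^_ k).
Proof.
elim: k => [|k IH]; first by rewrite subn0 ffactn0.
rewrite derivnS IH derivMn deriv_exp derivB derivX derivC subr0 mul1r.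
by rewrite -subnS -mulrnA mulnC ffactnSr.
Qed.

Lemma derivn_XsubC_exp_at a m k :
  (('X - a%:P) ^+ m)^`(k).[a] = (m == k)%:R * k`!%:R.
Proof.
rewrite derivn_XsubC_exp hornerMn horner_exp hornerXsubC subrr expr0n subn_eq0.
have [->|ne] := eqVneq m k; first by rewrite leqnn ffactnn mul1r.
rewrite mul0r; case: leqP => [mk|_]; last by rewrite mul0rn.
by rewrite ffact_small // ltn_neqAle ne.
Qed.

(** Multiplication by [X] is multiplication by [X - a] plus a scalar. *)
Lemma scalar_eq_shifted (phi psi : {scalar {poly K}}) a :
  (forall m, phi (('X - a%:P) ^+ m) = psi (('X - a%:P) ^+ m)) -> phi =1 psi.
Proof.
move=> H P; suff: forall m, phi (('X - a%:P) ^+ m * P) = psi (('X - a%:P) ^+ m * P).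
  by move/(_ 0%N); rewrite !expr0 !mul1r.
elim/poly_ind: P => [|P c IH] m; first by rewrite mulr0 !linear0.
have -> : ('X - a%:P) ^+ m * (P * 'X + c%:P) = ('X - a%:P) ^+ m.+1 * P +
    (a *: (('X - a%:P) ^+ m * P) + c *: ('X - a%:P) ^+ m).
  by rewrite exprSr -!mul_polyC; ring.
by rewrite !linearD !linearZ /= !IH H.
Qed.

(** Taylor expansion at [a], read through [phi]. *)
Lemma moment_jet (phi : {scalar {poly K}}) a D :
  (forall l, (D < l)%N -> phi (('X - a%:P) ^+ l) = 0) ->
  forall P, phi P = \sum_(k < D.+1) phi (('X - a%:P) ^+ k) / k`!%:R * P^`(k).[a].
Proof.
move=> phi0 P.
pose psi0 P := \sum_(k < D.+1) phi (('X - a%:P) ^+ k) / k`!%:R * P^`(k).[a].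
have psi_scalar : scalar psi0.
  move=> c P1 P2; rewrite /psi0 mulr_sumr -big_split /=; apply: eq_bigr => k _.
  by rewrite derivnD derivnZ hornerD hornerZ mulrDr mulrCA.
pose psi : {scalar {poly K}} := HB.pack psi0 (GRing.isLinear.Build _ _ _ _ psi0 psi_scalar).
apply: (@scalar_eq_shifted phi psi a) => m; rewrite /psi /= /psi0.
under eq_bigr do rewrite derivn_XsubC_exp_at.
have [mD|Dm] := leqP m D; last first.
  rewrite phi0 // big1 // => k _; rewrite gtn_eqF ?mul0r ?mulr0 //.
  by apply: leq_ltn_trans Dm; rewrite -ltnS ltn_ord.
rewrite (bigD1 (Ordinal (mD : (m < D.+1)%N))) //= eqxx mul1r divfK ?pnatr_eq0 -?lt0n ?fact_gt0 //.
rewrite big1 ?addr0 // => k km; rewrite [m == k](_ : _ = false) ?mul0r ?mulr0 //.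
by apply: contra_neqF km => /eqP mk; apply: val_inj.
Qed.

End Jets.

Section Evaluation.
Variable R : realType.
Local Notation C := (Cplx R).
Local Notation Cinf := (Cinf R).
Implicit Types (f g phi psi : Cinf) (p q P Q : {poly R[i]}) (a : C).

Lemma poly_opE p D (v : Cinf -> C) phi :
  poly_op p D v phi = \sum_(k < size p) p`_k * iter k D v phi :> R[i].
Proof.
rewrite /poly_op (big_morph (fun w : Cinf -> C => w phi) (id1 := 0) (op1 := +%R)) //.
Qed.

Lemma iter_distr_del k (v : Cinf -> C) phi :
  iter k (@distr_del R) v phi = (-1) ^+ k * v (iter k (@del R) phi) :> R[i].
Proof.
elim: k phi => [|k IH] phi; first by rewrite mul1r.
by rewrite iterS /distr_del IH -iterSr exprS mulN1r mulNr.
Qed.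

Lemma iter_distr_delbar k (v : Cinf -> C) phi :
  iter k (@distr_delbar R) v phi = (-1) ^+ k * v (iter k (@delbar R) phi) :> R[i].
Proof.
elim: k phi => [|k IH] phi; first by rewrite mul1r.
by rewrite iterS /distr_delbar IH -iterSr exprS mulN1r mulNr.
Qed.

Definition point_distr p q a : Cinf -> C :=
  poly_op p (@distr_del R) (poly_op q (@distr_delbar R) (dirac_distr a)).

Lemma point_distrE p q a phi : point_distr p q a phi =
  \sum_(k < size p) \sum_(l < size q) (p`_k * (-1) ^+ k) * (q`_l * (-1) ^+ l) *
    iter l (@delbar R) (iter k (@del R) phi) a :> R[i].
Proof.
rewrite /point_distr poly_opE; apply: eq_bigr => k _.
rewrite iter_distr_del poly_opE !mulr_sumr; apply: eq_bigr => l _.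
by rewrite iter_distr_delbar !mulrA.
Qed.

Lemma point_distr_product p q a f g : delbar f = 0 -> delbar g = 0 ->
  point_distr p q a (Cinf_mul f (Cinf_conj g)) =
  (\sum_(k < size p) p`_k * (-1) ^+ k * iter k (@del R) f a) *
  (\sum_(l < size q) q`_l * (-1) ^+ l * (iter l (@del R) g a)^*%C) :> R[i].
Proof.
move=> f0 g0; rewrite point_distrE mulr_suml; apply: eq_bigr => k _.
rewrite mulr_sumr; apply: eq_bigr => l _; rewrite wirtinger_mul //.
exact: mulrACA.
Qed.

End Evaluation.

(** * The characterization *)

Section FiniteOrder.
Variable R : realType.
Local Notation C := (Cplx R).
Local Notation Cinf := (Cinf R).
Implicit Types (f g phi psi : Cinf) (p q P Q : {poly R[i]}) (a : C) (v w : Cinf -> C).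

Lemma finite_order_dirac a : finite_order (dirac_distr a).
Proof.
exists 0%N, (Num.max `|complex.Re a| `|complex.Im a|), 1; split=> // f M M0 fM.
rewrite mul1r; apply: (fM 0%N 0%N a) => //.
by split; rewrite le_max lexx ?orbT.
Qed.

Lemma finite_order_wirtinger (i : R[i]) v : `|i| = 1 -> finite_order v ->
  finite_order (fun f => v (wirtinger i f)).
Proof.
move=> i1 [N [r [K [K0 vK]]]]; exists N.+1, r, K; split=> // f M M0 fM.
apply: vK => // j k z jN kN rz.
have -> : Cinf_dxdy j k (wirtinger i f) =
    (2%:R : R[i])^-1 *: (Cinf_dxdy j.+1 k f + i *: Cinf_dxdy j k.+1 f).
  by rewrite /wirtinger linearZ /= linearD /= linearZ /= Cinf_dxdy_dx Cinf_dxdy_dy.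
set x := Cinf_dxdy j.+1 k f; set y := Cinf_dxdy j k.+1 f.
change (`|2%:R^-1 * (x z + i * y z) : R[i]| <= M%:C).
have xM : `|x z : R[i]| <= M%:C by apply: fM => //; exact: leqW.
have yM : `|y z : R[i]| <= M%:C by apply: fM => //; exact: leqW.
move: (x z) (y z) xM yM => s t sM tM.
rewrite normrM normfV normr_nat ler_pdivrMl ?ltr0n // mulr_natl mulr2n.
by apply: le_trans (ler_normD _ _) _; rewrite normrM i1 mul1r lerD.
Qed.

Lemma finite_order_linear v w (c : R[i]) : finite_order v -> finite_order w ->
  finite_order (fun f => c * v f + w f : R[i]).
Proof.
move=> [N1 [r1 [K1 [K10 vK]]]] [N2 [r2 [K2 [K20 wK]]]].
have cE : `|c| = (complex.Re `|c|)%:C by rewrite RRe_real // normr_real.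
set t := complex.Re _ in cE; have t0 : 0 <= t by rewrite -ler0c -cE.
exists (maxn N1 N2), (Num.max r1 r2), (t * K1 + K2).
split; first by rewrite ltr_wpDl ?mulr_ge0 // ltW.
move=> f M M0 fM; rewrite mulrDl rmorphD.
apply: le_trans (ler_normD _ _) _; apply: lerD.
  rewrite normrM cE -mulrA rmorphM; apply: ler_wpM2l; first by rewrite ler0c.
  by apply: vK => //; apply: derivs_leW fM; rewrite ?leq_maxl // le_max lexx.
by apply: wK => //; apply: derivs_leW fM; rewrite ?leq_maxr // le_max lexx orbT.
Qed.

Lemma finite_order0 : finite_order (fun=> 0 : C).
Proof.
exists 0%N, 0, 1; split=> // f M M0 _.
by rewrite normr0 mul1r ler0c ltW.
Qed.

Lemma finite_order_sum n (c : nat -> R[i]) (v : nat -> Cinf -> C) :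
  (forall i, finite_order (v i)) ->
  finite_order (fun f => \sum_(i < n) c i * v i f : R[i]).
Proof.
move=> vo; elim: n => [|n IH].
  rewrite (_ : (fun _ => _) = fun=> 0); first exact: finite_order0.
  by apply/funext => f; rewrite big_ord0.
rewrite (_ : (fun _ => _) = fun f => c n * v n f + \sum_(i < n) c i * v i f : R[i]).
  exact: finite_order_linear.
by apply/funext => f; rewrite big_ord_recr /= addrC.
Qed.

Lemma finite_order_point_distr p q a : finite_order (point_distr p q a).
Proof.
have del_order v k : finite_order v -> finite_order (fun f => v (iter k (@del R) f)).
  elim: k => [|k IH] vo //; rewrite (_ : (fun _ => _) =
    fun f => (fun g => v (iter k (@del R) g)) (wirtinger (- 'i) f)).
    by apply: finite_order_wirtinger (IH vo); rewrite normrN normc_i.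
  by apply/funext => f; rewrite iterSr delE.
have delbar_order v k : finite_order v -> finite_order (fun f => v (iter k (@delbar R) f)).
  elim: k => [|k IH] vo //; rewrite (_ : (fun _ => _) =
    fun f => (fun g => v (iter k (@delbar R) g)) (wirtinger 'i f)).
    by apply: finite_order_wirtinger (IH vo); exact: normc_i.
  by apply/funext => f; rewrite iterSr.
rewrite (_ : point_distr p q a = fun f => \sum_(k < size p) (p`_k * (-1) ^+ k) *
  (\sum_(l < size q) (q`_l * (-1) ^+ l) *
    iter l (@delbar R) (iter k (@del R) f) a) : R[i]).
  apply: (@finite_order_sum _ (fun k => p`_k * (-1) ^+ k) (fun k f =>
    \sum_(l < size q) (q`_l * (-1) ^+ l) *
      iter l (@delbar R) (iter k (@del R) f) a)) => k.
  apply: (@finite_order_sum _ (fun l => q`_l * (-1) ^+ l) (fun l f =>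
    iter l (@delbar R) (iter k (@del R) f) a)) => l.
  exact: (del_order _ k (delbar_order _ l (finite_order_dirac a))).
apply/funext => f; rewrite [LHS]point_distrE; apply: eq_bigr => k _.
by rewrite [RHS]mulr_sumr; apply: eq_bigr => l _; rewrite [RHS]mulrA.
Qed.

Lemma iter_linear (T : Cinf -> Cinf) k : linear T -> linear (iter k T).
Proof. by move=> Tl; elim: k => [|k IH] // c f g; rewrite !iterS IH Tl. Qed.

Lemma point_distr_linear p q a : linear (point_distr p q a).
Proof.
move=> c f g; rewrite [LHS]point_distrE.
rewrite -[RHS]/(c * point_distr p q a f + point_distr p q a g) !point_distrE.
rewrite mulr_sumr -big_split; apply: eq_bigr => k _ /=.
rewrite mulr_sumr -big_split; apply: eq_bigr => l _ /=.
rewrite (iter_linear k (@del_is_linear R)) (iter_linear l (@delbar_is_linear R)).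
set x := iter l _ (iter k _ f); set y := iter l _ (iter k _ g).
set b := _ * (_ * _); change (b * (c * x a + y a) = c * (b * x a) + b * y a).
by rewrite mulrDr mulrCA.
Qed.

End FiniteOrder.

Section Main.
Variable R : realType.
Local Notation C := (Cplx R).
Local Notation Cinf := (Cinf R).
Implicit Types (f g : Cinf) (p q P Q : {poly R[i]}) (a : C).

Lemma Cinf_conj1 : Cinf_conj (cpoly 1) = cpoly (1 : {poly R[i]}).
Proof.
apply: CinfE => z; change (((1 : {poly R[i]}).[z])^*%C = (1 : {poly R[i]}).[z]).
by rewrite hornerC rmorph1.
Qed.

Lemma cinf0 (z : C) : (0 : Cinf) z = 0 :> R[i].
Proof. by []. Qed.

Lemma iter_del1 k : iter k.+1 (@del R) (cpoly 1) = 0.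
Proof.
elim: k => [|k IH]; first by rewrite [LHS]del_cpoly derivC linear0.
by rewrite iterS IH linear0.
Qed.

Lemma size_gt0_horner0 p : p.[0] = 1 -> (0 < size p)%N.
Proof.
move=> p1; rewrite size_poly_gt0; apply/eqP => p0; move/eqP: p1.
by rewrite p0 horner0 eq_sym oner_eq0.
Qed.

(** The constant terms of [p] and [q] make the value of each factor at the
    function 1 equal to 1. *)
Lemma point_distr_WM p q a : p.[0] = 1 -> q.[0] = 1 ->
  weakly_multiplicative (point_distr p q a).
Proof.
move=> p1 q1.
have jet1 (h : {poly R[i]}) : h.[0] = 1 ->
    \sum_(k < size h) h`_k * (-1) ^+ k * (iter k (@del R) (cpoly 1) a) = 1 :> R[i].
  move=> h1; have := size_gt0_horner0 h1; case E : (size h) => [//|n] _.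
  rewrite big_ord_recl big1 ?addr0 => [|k _].
    by rewrite /= expr0 mulr1 -horner_coef0 h1 mul1r hornerC.
  by rewrite lift0 iter_del1 cinf0 mulr0.
have jet1c (h : {poly R[i]}) : h.[0] = 1 ->
    \sum_(k < size h) h`_k * (-1) ^+ k * (iter k (@del R) (cpoly 1) a)^*%C = 1 :> R[i].
  move=> h1; have := size_gt0_horner0 h1; case E : (size h) => [//|n] _.
  rewrite big_ord_recl big1 ?addr0 => [|k _].
    by rewrite /= expr0 mulr1 -horner_coef0 h1 mul1r hornerC rmorph1.
  by rewrite lift0 iter_del1 cinf0 rmorph0 mulr0.
have e1 : entire (cpoly (1 : {poly R[i]})) by exact: cpoly_entire.
move=> f g /delbar_entire f0 /delbar_entire g0.
have d1 := delbar_entire e1.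
have Ef := point_distr_product p q a f0 d1.
have Eg := point_distr_product p q a d1 g0.
rewrite Cinf_conj1 Cinf_mul1 jet1c // mulr1 in Ef.
rewrite Cinf_mulC Cinf_mul1 jet1 // mul1r in Eg.
by rewrite [LHS]point_distr_product // -Eg -Ef.
Qed.

Lemma sum_poly_coef (n : nat) (c F : nat -> R[i]) :
  \sum_(k < size (\poly_(i < n) c i)) (\poly_(i < n) c i)`_k * F k = \sum_(k < n) c k * F k.
Proof.
set p := \poly_(i < n) c i; transitivity (\sum_(k < n) p`_k * F k).
  rewrite (big_ord_widen n (fun k => p`_k * F k)) ?size_poly // big_mkcond.
  by apply: eq_bigr => k _; case: ltnP => // /(nth_default 0) ->; rewrite mul0r.
by apply: eq_bigr => k _; rewrite coef_poly ltn_ord.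
Qed.

(** The coefficients of [p] and [q] are the moments about [a], with the signs and
    factorials of [moment_jet]; density extends the equality to all smooth
    functions. *)
Lemma WM_is_point_distr (u : {linear Cinf -> C}) :
  finite_order u -> weakly_multiplicative u -> u (cpoly 1) = 1 ->
  exists a p q, [/\ p.[0] = 1, q.[0] = 1 & forall f, u f = point_distr p q a f].
Proof.
move=> uo wm u1.
have [a [D aD]] := WM_moments_vanish uo wm u1.
pose A k := hol_moment u (('X - a%:P) ^+ k).
pose B k := antihol_moment u (('X - a%:P) ^+ k).
pose p := \poly_(k < D.+1) ((-1) ^+ k * (A k / k`!%:R)).
pose q := \poly_(k < D.+1) ((-1) ^+ k * ((B k)^*%C / k`!%:R)).
have p1 : p.[0] = 1.
  by rewrite horner_coef0 coef_poly /= /A !expr0 mul1r fact0 divr1.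
have q1 : q.[0] = 1.
  rewrite horner_coef0 coef_poly /= /B !expr0 mul1r fact0 divr1.
  by rewrite /antihol_moment Cinf_conj1 u1 rmorph1 rmorph1.
exists a, p, q; split => //.
have holE P : hol_moment u P = \sum_(k < size p) p`_k * (-1) ^+ k * (iter k (@del R) (cpoly P) a).
  rewrite (moment_jet (fun l Dl => (aD l Dl).1)).
  under [RHS]eq_bigr do rewrite -mulrA.
  rewrite (sum_poly_coef D.+1 _ (fun k => (-1) ^+ k * iter k (@del R) (cpoly P) a)).
  apply: eq_bigr => k _; rewrite iter_del_cpoly /A.
  by rewrite [RHS]mulrACA -[in RHS]expr2 sqrr_sign mul1r.
have antiholE Q : (antihol_moment u Q)^*%C =
    \sum_(l < size q) q`_l * (-1) ^+ l * (iter l (@del R) (cpoly Q) a)^*%C.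
  rewrite (moment_jet (fun l Dl => (aD l Dl).2)) rmorph_sum.
  under [RHS]eq_bigr do rewrite -mulrA.
  rewrite (sum_poly_coef D.+1 _ (fun l => (-1) ^+ l * (iter l (@del R) (cpoly Q) a)^*%C)).
  apply: eq_bigr => l _; rewrite iter_del_cpoly -/(B l).
  rewrite [RHS]mulrACA -[in RHS]expr2 sqrr_sign mul1r.
  by rewrite rmorphM; congr (_ * _); rewrite rmorphM fmorphV rmorph_nat.
pose w0 f := u f - point_distr p q a f.
have w0_linear : linear w0.
  move=> c f g; rewrite /w0 linearP point_distr_linear.
  by rewrite opprD addrACA -scalerN -scalerDr.
pose w : {linear Cinf -> C} := HB.pack w0 (GRing.isLinear.Build _ _ _ _ w0 w0_linear).
have wo : finite_order w.
  have := finite_order_linear (-1) (finite_order_point_distr p q a) uo.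
  by congr finite_order; apply/funext => f; rewrite /w /= /w0 mulN1r addrC.
have w_pair P Q : w (cpair P Q) = 0.
  apply/eqP; rewrite subr_eq0; apply/eqP.
  have dP := delbar_entire (@cpoly_entire R P); have dQ := delbar_entire (@cpoly_entire R Q).
  rewrite [RHS](point_distr_product p q a dP dQ) [LHS](WM_cpair wm).
  by congr (_ * _); [exact: holE | exact: antiholE].
move=> f; apply/eqP; rewrite -subr_eq0; apply/eqP.
exact: (polynomials_dense wo w_pair f).
Qed.

End Main.

Theorem theorem1p1 (R : realType) (u : {linear Cinf R -> Cplx R})
    (u_continuous : continuous u) :
  weakly_multiplicative u <->
  (u = 0 :> (Cinf R -> Cplx R)) \/
  (exists (a : Cplx R) (p q : {poly R[i]}),
      [/\ p.[0] = 1, q.[0] = 1 &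
          u = poly_op p (@distr_del R)
                (poly_op q (@distr_delbar R) (dirac_distr a))
            :> (Cinf R -> Cplx R)]).
Proof.
split=> [wm|[u0|[a [p [q [p1 q1 uE]]]]]]; last 2 first.
- by rewrite u0 => f g _ _; rewrite /= mul0r.
- by rewrite uE; exact: point_distr_WM.
have uo := continuous_finite_order u_continuous.
have e1 : entire (cpoly (1 : {poly R[i]})) by exact: cpoly_entire.
have uu : u (cpoly 1) = u (cpoly 1) * u (cpoly 1) :> R[i].
  by have := wm _ _ e1 e1; rewrite Cinf_conj1 Cinf_mul1.
have [u1|u1] := eqVneq (u (cpoly 1) : R[i]) 0.
  left; apply/funext => f; apply: (polynomials_dense uo _ f) => P Q.
  have hol0 P' : hol_moment u P' = 0.
    have := wm _ _ (@cpoly_entire R P') e1; rewrite Cinf_conj1 Cinf_mul1 u1 mulr0.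
    exact.
  by rewrite (WM_cpair wm) hol0 mul0r.
right; have {}uu : u (cpoly 1) = 1.
  by apply: (mulfI u1); rewrite mulr1 -uu.
have [a [p [q [p1 q1 uE]]]] := WM_is_point_distr uo wm uu.
by exists a, p, q; split => //; apply/funext => f; exact: uE.
Qed.
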